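(* There exists a family $(G_n)_{n\in\mathbb{N}}$ of torsion-free, finitely generated, two-step nilpotent groups such that $k(G_n)=1$ for all $n\in\mathbb{N}$ (so that $\mathrm{RF}_{G_n}\approx\log^3$ for all $n$), while $\psi(G_n)\to\infty$ as $n\to\infty$.
   Context: $\mathbb{N}=\{1,2,\ldots\}$. Residual finiteness growth: let $G$ be a finitely generated residually finite group with finite generating set $S$, neutral element $e$, and word norm $\|\cdot\|_S$; put $B_S(r)=\{g\in G\mid \|g\|_S\le r\}$. Let $D_G(g)=\min\{[G:N]\mid g\notin N, N\lhd G\}$ for $g\ne e$, and $\mathrm{RF}_{G,S}(r)=\max\{D_G(g)\mid e\neq g\in B_S(r)\}$ for real $r\geq 1$. For non-decreasing functions on $\mathbb{R}_{\ge1}$, $f\preceq g$ means there is $C>0$ with $f(r)\le C g(Cr)$ for all $r\ge\max\{1,1/C\}$, and $f\approx g$ means $f\preceq g$ and $g\preceq f$. $\mathrm{RF}_G$ is the $\approx$-class of $\mathrm{RF}_{G,S}$ (independent of $S$); $\log^k$ is $r\mapsto(\log r)^k$. The groups $G_\varphi$: let $\varphi:\mathbb{Z}^m\times\mathbb{Z}^m\to\mathbb{Z}^n$ be a bilinear map that is alternating ($\varphi(w,w')=-\varphi(w',w)$) and full (its values generate a finite index subgroup of $\mathbb{Z}^n$). Write $\varphi(w,w')=(w^TA_1w',\dots,w^TA_nw')^T$ with $A_i\in\mathbb{Z}^{m\times m}$ skew-symmetric, let $A_i^L$ be $A_i$ with its upper triangular part set to zero, and $\varphi^L(w,w')=(w^TA_1^Lw',\dots,w^TA_n^Lw')^T$.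 $G_\varphi$ is the set $\mathbb{Z}^m\times\mathbb{Z}^n$ with product $(w_1,v_1)(w_2,v_2)=(w_1+w_2,v_1+v_2+\varphi^L(w_1,w_2))$. Every torsion-free, finitely generated, two-step nilpotent group is isomorphic to some $G_\varphi$. The constant $k(G)$: put $$d(\varphi^{\mathbb{C}})=\min\Big\{\max_{1\le j\le n}\operatorname{rank}_{\mathbb{C}}\sum_{i=1}^n a^{(j)}_iA_i\ \Big|\ a^{(1)},\dots,a^{(n)}\text{ is a basis of }\mathbb{C}^n\Big\}.$$ This number is even and depends only on the isomorphism class of the group. For $G\cong G_\varphi$, $k(G)=d(\varphi^{\mathbb{C}})/2$. The constant $\psi(G)$: let $G$ be a finitely generated torsion-free nilpotent group of class $c$, with center $Z(G)$, and let $h$ denote Hirsch length. For $e\ne g\in Z(G)$ let $\psi(g)$ be the minimum of $h(G/N)$ over all normal subgroups $N$ such that $G/N$ is torsion-free, $G/N$ is irreducible (not a direct product of two non-trivial groups), and, with $\pi_N:G\to G/N$ the projection, $\langle\pi_N(g)\rangle$ is a non-trivial finite index subgroup of $Z(G/N)$. Then $$\psi(G)=\max\{\psi(g)\mid e\ne g\in Z(G),\ \exists k\in\mathbb{N},\ \exists a\in G_{c-1},\ \exists b\in G:\ g^k=[a,b]\},$$ where $G_{c-1}$ is the $(c-1)$-th term of the lower central series ($G_1=G$). *)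

(* Defs.v *)
From HB Require Import structures.
From mathcomp Require Import all_boot all_order all_algebra.
From mathcomp Require Import complex.
From mathcomp Require Import all_classical all_reals all_analysis.

Set Implicit Arguments.
Unset Strict Implicit.
Unset Printing Implicit Defensive.

Import Order.TTheory GRing.Theory Num.Theory.
Local Open Scope classical_set_scope.
Local Open Scope quotient_scope.

(* Minimum and maximum of a set of natural numbers; both take the junk value 0
   when there is no such element. *)
Definition natmin (A : set nat) : nat := xget 0 (A `&` lbound A).
Definition natmax (A : set nat) : nat := xget 0 (A `&` ubound A).

Section Groups.
Local Open Scope group_scope.

Definition is_subgroup (G : groupType) (H : set G) : Prop :=
  H 1 /\ forall x y, H x -> H y -> H (x / y).

Definition generated (G : groupType) (A : set G) : set G :=
  smallest (@is_subgroup G) A.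

Definition normal_in (G : groupType) (K H : set G) : Prop :=
  [/\ is_subgroup K, is_subgroup H, K `<=` H &
      forall k h, K k -> H h -> K (k ^ h)].

Definition lcosets (G : groupType) (H K : set G) : set (set G) :=
  [set [set x * k | k in K] | x in H].

Definition has_index (G : groupType) (H K : set G) (d : nat) : Prop :=
  (lcosets H K #= `I_d)%card.

Definition center (G : groupType) : set G := [set z | forall x, z * x = x * z].
#[global] Arguments center : clear implicits.
Definition torsion_free (G : groupType) : Prop :=
  forall (g : G) (k : nat), (0 < k)%N -> g ^+ k = 1 -> g = 1.

Definition isomorphic (G H : groupType) : Prop :=
  exists f : {multiplicative G -> H}, bijective f.

Definition nontrivial (G : groupType) : Prop := exists g : G, g <> 1.

Definition irreducible_group (G : groupType) : Prop :=
  ~ exists A B : groupType,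
      [/\ nontrivial A, nontrivial B & isomorphic G (A * B)%type].

Definition generates (G : groupType) (S : set G) : Prop :=
  generated S = [set: G].

Definition finitely_generated (G : groupType) : Prop :=
  exists S : set G, finite_set S /\ generates S.

(* 1-based: lcs G 1 = G and lcs G i.+1 = [lcs G i, G] for 0 < i. *)
Definition lcs (G : groupType) (i : nat) : set G :=
  iter i.-1
    (fun H : set G => generated [set [~ a, b] | a in H & b in [set: G]])
    [set: G].
#[global] Arguments lcs : clear implicits.

Definition nilpotent (G : groupType) : Prop :=
  exists c : nat, lcs G c.+1 = [set 1].

Definition nil_class (G : groupType) : nat :=
  natmin [set c | lcs G c.+1 = [set 1]].

Definition two_step_nilpotent (G : groupType) : Prop :=
  nilpotent G /\ nil_class G = 2.

(* Hirsch length: the number of infinite factors in a subnormal series with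
   cyclic factors.  In a step from K to H, the factor H / K is generated by
   the class of x. *)
Inductive hirsch_series (G : groupType) : set G -> nat -> Prop :=
| HirschTriv : hirsch_series [set 1] 0
| HirschFin (K H : set G) (x : G) (h : nat) :
    hirsch_series K h -> normal_in K H -> H = generated (K `|` [set x]) ->
    (exists2 k : nat, (0 < k)%N & K (x ^+ k)) -> hirsch_series H h
| HirschInf (K H : set G) (x : G) (h : nat) :
    hirsch_series K h -> normal_in K H -> H = generated (K `|` [set x]) ->
    (forall k : nat, (0 < k)%N -> ~ K (x ^+ k)) -> hirsch_series H h.+1.

(* The number h does not depend on the series, so that the choice made by xget
   is immaterial for polycyclic groups. *)
Definition hirsch (G : groupType) : nat :=
  xget 0 [set h | hirsch_series [set: G] h].

End Groups.

Section Quotient.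
Local Open Scope group_scope.

Record normalSubgroup (G : groupType) := NormalSubgroup {
  nsub_set : set G;
  nsubP : normal_in nsub_set [set: G]
}.

Variables (G : groupType) (N : normalSubgroup G).

Lemma nsub1 : nsub_set N 1. Proof. by have [[]] := nsubP N. Qed.

Lemma nsubF x y : nsub_set N x -> nsub_set N y -> nsub_set N (x / y).
Proof. by have [[_ NF] _ _ _] := nsubP N; exact: NF. Qed.

Lemma nsubV x : nsub_set N x -> nsub_set N x^-1.
Proof. by move=> Nx; rewrite -[x^-1]mul1g; exact: nsubF nsub1 Nx. Qed.

Lemma nsubM x y : nsub_set N x -> nsub_set N y -> nsub_set N (x * y).
Proof. by move=> Nx /nsubV Ny; rewrite -[y]invgK; exact: nsubF. Qed.

Lemma nsubJ x y : nsub_set N x -> nsub_set N (x ^ y).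
Proof. by move=> Nx; have [_ _ _] := nsubP N; apply. Qed.

Definition nsub_rel : rel G := fun x y => `[< nsub_set N (x^-1 * y) >].

Lemma nsub_rel_refl : reflexive nsub_rel.
Proof. by move=> x; apply/asboolP; rewrite mulVg; exact: nsub1. Qed.

Lemma nsub_rel_sym : symmetric nsub_rel.
Proof.
suff H x y : nsub_rel x y -> nsub_rel y x by move=> x y; apply/idP/idP; exact: H.
by move=> /asboolP /nsubV; rewrite invgM invgK => ?; exact/asboolP.
Qed.

Lemma nsub_rel_trans : transitive nsub_rel.
Proof.
move=> y x z /asboolP Nxy /asboolP Nyz; apply/asboolP.
by have := nsubM Nxy Nyz; rewrite -mulgA mulVKg.
Qed.

Canonical nsub_equiv :=
  EquivRel nsub_rel nsub_rel_refl nsub_rel_sym nsub_rel_trans.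

Definition quotient := {eq_quot nsub_equiv}.
HB.instance Definition _ := Choice.on quotient.

Definition qpi (x : G) : quotient := \pi_({eq_quot nsub_equiv}) x.
Definition qmul (a b : quotient) : quotient := qpi (repr a * repr b).
Definition qinv (a : quotient) : quotient := qpi (repr a)^-1.

Lemma qpiP x y : qpi x = qpi y <-> nsub_set N (x^-1 * y).
Proof.
split; first by move/eqquotP => /asboolP.
by move=> Nxy; apply/eqquotP/asboolP.
Qed.

Lemma qpi_repr a : qpi (repr a) = a. Proof. exact: reprK. Qed.

Lemma qpiM x y : qpi (x * y) = qmul (qpi x) (qpi y).
Proof.
apply/qpiP; set x' := repr _; set y' := repr _.
have Nx : nsub_set N (x^-1 * x') by apply/qpiP; rewrite qpi_repr.
have Ny : nsub_set N (y^-1 * y') by apply/qpiP; rewrite qpi_repr.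
have -> : (x * y)^-1 * (x' * y') = (x^-1 * x') ^ y * (y^-1 * y').
  by rewrite invgM /conjg !mulgA mulgK.
exact: nsubM (nsubJ _ Nx) Ny.
Qed.

Lemma qpiV x : qpi x^-1 = qinv (qpi x).
Proof.
apply/qpiP; set x' := repr _.
have Nx : nsub_set N (x'^-1 * x) by apply/qpiP; rewrite qpi_repr.
have -> : x^-1^-1 * x'^-1 = (x'^-1 * x) ^ x'^-1.
  by rewrite /conjg !invgK !mulgA mulgV mul1g.
exact: nsubJ.
Qed.

Lemma qmulA : associative qmul.
Proof.
by move=> a b c; rewrite -[a]qpi_repr -[b]qpi_repr -[c]qpi_repr -!qpiM mulgA.
Qed.

Lemma qmul1 : left_id (qpi 1) qmul.
Proof. by move=> a; rewrite -[a]qpi_repr -qpiM mul1g. Qed.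

Lemma qmulr1 : right_id (qpi 1) qmul.
Proof. by move=> a; rewrite -[a]qpi_repr -qpiM mulg1. Qed.

Lemma qmulV : left_inverse (qpi 1) qinv qmul.
Proof. by move=> a; rewrite -[a]qpi_repr -qpiV -qpiM mulVg. Qed.

Lemma qmulrV : right_inverse (qpi 1) qinv qmul.
Proof. by move=> a; rewrite -[a]qpi_repr -qpiV -qpiM mulgV. Qed.

HB.instance Definition _ :=
  isGroup.Build quotient qmulA qmul1 qmulr1 qmulV qmulrV.

End Quotient.

Section ResidualFinitenessGrowth.
Local Open Scope group_scope.
Variables (R : realType) (G : groupType).

Definition word_norm (S : set G) (g : G) : nat :=
  natmin [set size w | w in [set w : seq G |
    (forall x, x \in w -> S x \/ S x^-1) /\ \prod_(x <- w) x = g]].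

Definition ball_word (S : set G) (r : R) : set G :=
  [set g | ((word_norm S g)%:R <= r)%R].

Definition Ddiv (g : G) : nat :=
  natmin [set d | exists N : set G,
    [/\ normal_in N [set: G], ~ N g & has_index [set: G] N d]].

Definition RF (S : set G) (r : R) : nat :=
  natmax [set Ddiv g | g in [set g | g <> 1 /\ ball_word S r g]].

End ResidualFinitenessGrowth.

Section Growth.
Local Open Scope ring_scope.
Variable R : realType.

(* Only the values on [1, +oo[ matter: C * r >= 1 whenever r >= C^-1. *)
Definition growth_le (f g : R -> R) : Prop :=
  exists2 C : R, 0 < C &
    forall r : R, Num.max 1 C^-1 <= r -> f r <= C * g (C * r).

Definition growth_eq (f g : R -> R) : Prop := growth_le f g /\ growth_le g f.

(* The class RF_G is that of f: all generating sets are considered. *)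
Definition RF_class (G : groupType) (f : R -> R) : Prop :=
  forall S : set G, finite_set S -> generates S ->
    growth_eq (fun r => (RF S r)%:R) f.

End Growth.

(* A is a parameter of the type because the group law depends on it. *)
Record Gphi (m n : nat) (A : 'I_n -> 'M[int]_m) :=
  MkGphi { gphi_val : 'cV[int]_m * 'cV[int]_n }.

HB.instance Definition _ m n (A : 'I_n -> 'M[int]_m) :=
  [isNew for @gphi_val m n A].
HB.instance Definition _ m n (A : 'I_n -> 'M[int]_m) :=
  [Choice of Gphi A by <:].

Section GphiLaw.
Local Open Scope ring_scope.
Variables (m n : nat) (A : 'I_n -> 'M[int]_m).

Definition form (B : 'I_n -> 'M[int]_m) (w w' : 'cV[int]_m) : 'cV[int]_n :=
  \col_i (w^T *m B i *m w') 0 0.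

Definition skew : Prop := forall i, (A i)^T = - A i.

Definition form_span : set 'cV[int]_n :=
  smallest [set H : set 'cV[int]_n |
              H 0 /\ forall u v, H u -> H v -> H (u - v)]
           [set form A w w' | w in [set: 'cV[int]_m] & w' in [set: 'cV[int]_m]].

Definition full : Prop :=
  finite_set [set [set v + s | s in form_span] | v in [set: 'cV[int]_n]].

Definition lower_part (i : 'I_n) : 'M[int]_m :=
  \matrix_(p, q) if (q < p)%N then A i p q else 0.

Definition formL := form lower_part.

Lemma formLDl w1 w2 w : formL (w1 + w2) w = formL w1 w + formL w2 w.
Proof.
apply/colP => i; rewrite [RHS]mxE [LHS]mxE [X in _ = X + _]mxE.
by rewrite [X in _ = _ + X]mxE linearD /= !mulmxDl [LHS]mxE.
Qed.

Lemma formLDr w w1 w2 : formL w (w1 + w2) = formL w w1 + formL w w2.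
Proof.
apply/colP => i; rewrite [RHS]mxE [LHS]mxE [X in _ = X + _]mxE.
by rewrite [X in _ = _ + X]mxE mulmxDr [LHS]mxE.
Qed.

Lemma formL0l w : formL 0 w = 0.
Proof. by apply: (@addrI _ (formL 0 w)); rewrite -formLDl !addr0. Qed.

Lemma formL0r w : formL w 0 = 0.
Proof. by apply: (@addrI _ (formL w 0)); rewrite -formLDr !addr0. Qed.

Lemma formLNl w w' : formL (- w) w' = - formL w w'.
Proof. by apply/eqP; rewrite -addr_eq0 -formLDl addNr formL0l. Qed.

Lemma formLNr w w' : formL w (- w') = - formL w w'.
Proof. by apply/eqP; rewrite -addr_eq0 -formLDr addNr formL0r. Qed.

Local Notation Gphi := (Gphi A).
Local Notation MkGphi := (MkGphi A).

Definition gphi_mul (g h : Gphi) : Gphi :=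
  let: (w1, v1) := gphi_val g in let: (w2, v2) := gphi_val h in
  MkGphi (w1 + w2, v1 + v2 + formL w1 w2).

Definition gphi_inv (g : Gphi) : Gphi :=
  let: (w, v) := gphi_val g in MkGphi (- w, - v + formL w w).

Definition gphi_one : Gphi := MkGphi (0, 0).

Lemma gphi_mulA : associative gphi_mul.
Proof.
move=> [[w1 v1]] [[w2 v2]] [[w3 v3]]; rewrite /gphi_mul /=.
congr (MkGphi (_, _)); first exact: addrA.
rewrite formLDl formLDr -!addrA; congr (_ + (_ + _)).
by rewrite [RHS]addrCA [X in _ + X = _]addrC -addrA.
Qed.

Lemma gphi_mul1 : left_id gphi_one gphi_mul.
Proof. by move=> [[w v]]; rewrite /gphi_mul /= formL0l !add0r addr0. Qed.

Lemma gphi_mulr1 : right_id gphi_one gphi_mul.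
Proof. by move=> [[w v]]; rewrite /gphi_mul /= formL0r !addr0. Qed.

Lemma gphi_mulV : left_inverse gphi_one gphi_inv gphi_mul.
Proof.
move=> [[w v]]; rewrite /gphi_mul /= formLNl addNr.
by rewrite addrAC addrK addNr.
Qed.

Lemma gphi_mulrV : right_inverse gphi_one gphi_inv gphi_mul.
Proof.
move=> [[w v]]; rewrite /gphi_mul /= formLNr addrN.
by rewrite addrA addrN add0r addrN.
Qed.

HB.instance Definition _ :=
  isGroup.Build Gphi gphi_mulA gphi_mul1 gphi_mulr1 gphi_mulV gphi_mulrV.

Definition form_comb (R : realType) (c : 'cV[R[i]]_n) : 'M[R[i]]_m :=
  \sum_(i < n) c i 0 *: map_mx intr (A i).

Definition d_form (R : realType) : nat :=
  natmin [set d | exists a : n.-tuple 'cV[R[i]]_n,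
    basis_of fullv a /\ d = (\max_(j < n) \rank (form_comb (tnth a j)))%N].

End GphiLaw.

(* The number d_form is even and depends only on the isomorphism class of the
   group, so that the graph below determines k: k_const R G k means k(G) = k. *)
Definition k_const (R : realType) (G : groupType) (k : nat) : Prop :=
  exists (m n : nat) (A : 'I_n -> 'M[int]_m),
    [/\ skew A, full A, isomorphic G (Gphi A) & d_form A R = k.*2].

Section Psi.
Local Open Scope group_scope.
Variable G : groupType.

Definition psi_elt (g : G) : nat :=
  natmin [set h | exists N : normalSubgroup G,
    [/\ torsion_free (quotient N), irreducible_group (quotient N),
        qpi N g <> 1 /\ generated [set qpi N g] `<=` center (quotient N),
        exists d, has_index (center (quotient N)) (generated [set qpi N g]) d
      & h = hirsch (quotient N)]].

Definition psi_const : nat :=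
  natmax [set psi_elt g | g in [set g : G |
    [/\ center G g, g <> 1 &
        exists (k : nat) (a b : G),
          [/\ (0 < k)%N, lcs G (nil_class G).-1 a & g ^+ k = [~ a, b]]]]].

End Psi.

(* Main.v *)
Require Import Defs.
From mathcomp Require Import all_boot all_order all_algebra.
From mathcomp Require Import complex separable algC.
From mathcomp Require perm cyclic.
From mathcomp Require Import all_classical all_reals all_analysis.
From mathcomp Require Import zify ring lra.
Set Implicit Arguments.
Unset Strict Implicit.
Unset Printing Implicit Defensive.
Import Order.TTheory GRing.Theory Num.Theory.
Local Open Scope classical_set_scope.
Local Open Scope ring_scope.

(**
G_n is the Heisenberg group over the order O = Z[t]/(t^d - 3) with d = 3^n: triples (x, y, z) over
O with (x, y, z)(x', y', z') = (x + x', y + y', z + z' - y x').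

Over C the order splits, t going to the d roots of X^d - 3, so the commutator form is a direct sum
of d forms of rank 2 and k = 1.  Over Q the order is a field, so a torsion-free quotient in which
some central element survives is a quotient by a central subgroup; if its center has rank one, its
Hirsch length is 2d + 1.

For RF, cubing is a bijection on the units modulo a prime power q = 2 mod 3, so t can be sent to a
root of X^d - 3 in Z/q and G_n maps to the Heisenberg group over Z/q, of order q^3.  A nonzero
element of O that is killed for all such q <= X has a norm divisible by all of them, and their least
common multiple is exponential in X by a Chebyshev argument for primes that are 2 mod 3; hence
RF <= C log^3.  Conversely, if [x, y]^(L^2) survives in a finite quotient, where L is the least
common multiple of 1, ..., m, then [x, y] has order greater than m there, so the quotient has at
least m^3 elements, while log L = O(m) and [x, y]^(L^2) = [x^L, y^L] has word length O(L).
*)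

(** * Chebyshev bounds for primes congruent to 2 modulo 3 *)

(** The radicand 3 serves twice: it makes X^d - 3 Eisenstein at 3, and it is a unit modulo every q =
    2 mod 3. As all degrees are powers of 3, the same moduli serve every d, and one elementary
    estimate replaces a density theorem for each field. That estimate weighs prime powers by von
    Mangoldt's function, which turns the logarithm of a least common multiple into an exact sum;
    hence the congruence is imposed on q itself and selects the odd powers of the primes that are 2
    mod 3.

    Chebyshev's method alone does not exclude that almost all primes are 1 mod 3. The nontrivial
    character modulo 3 does: summed against ln, it bounds the class 1 on ]x/2, x] by the class 2 up
    to x, with an error ln x.

    The other obstacle is that Hirsch lengths, minima and maxima are chosen values with default 0.
    So the length of every series of a quotient is computed, as a rank over Q plus one, and each
    minimum or maximum in use comes with a proof that it exists. *)

Section PrimePowerSums.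
Variables (R : realType) (B : nat).

(** The sum of [F] against von Mangoldt's function. The cut-off [B] makes it finite; the functions
    evaluated exactly below vanish at all prime powers beyond some argument that is assumed smaller
    than [B]. *)
Definition ppsum (F : nat -> R) : R :=
  \sum_(p < B | prime p) \sum_(1 <= j < B) ln (p%:R : R) * F (p ^ j)%N.

Lemma ln_natr_ge0 n : 0 <= ln (n%:R : R).
Proof. by case: n => [|n]; [rewrite ln0 | apply: ln_ge0; rewrite ler1n]. Qed.

Lemma ler_ppsum F G :
  (forall p j, prime p -> (0 < j)%N -> F (p ^ j)%N <= G (p ^ j)%N) ->
  ppsum F <= ppsum G.
Proof.
move=> FG; apply: ler_sum => p pp; rewrite !big_nat; apply: ler_sum => j /andP[j0 _].
by rewrite ler_wpM2l ?ln_natr_ge0 ?FG.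
Qed.

Lemma eq_ppsum F G :
  (forall p j, prime p -> (0 < j)%N -> F (p ^ j)%N = G (p ^ j)%N) ->
  ppsum F = ppsum G.
Proof. by move=> FG; apply/le_anti/andP; split; apply: ler_ppsum => p j *; rewrite FG. Qed.

Lemma ppsumD F G : ppsum (fun q => F q + G q) = ppsum F + ppsum G.
Proof.
rewrite -big_split; apply: eq_bigr => p _; rewrite -big_split.
by apply: eq_bigr => j _; rewrite /= mulrDr.
Qed.

Lemma ppsumZ a F : ppsum (fun q => a * F q) = a * ppsum F.
Proof.
rewrite mulr_sumr; apply: eq_bigr => p _; rewrite mulr_sumr.
by apply: eq_bigr => j _; rewrite mulrCA.
Qed.

Lemma ppsum_sum (I : Type) (r : seq I) F :
  ppsum (fun q => \sum_(i <- r) F i q) = \sum_(i <- r) ppsum (F i).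
Proof.
elim: r => [|i r IH]; last first.
  by rewrite big_cons -IH -ppsumD; apply: eq_ppsum => p j _ _; rewrite big_cons.
rewrite big_nil /ppsum big1 // => p _; rewrite big1 // => j _.
by rewrite big_nil mulr0.
Qed.

Lemma ln_prod (I : Type) (r : seq I) (P : pred I) (F : I -> R) :
  (forall i, P i -> 0 < F i) ->
  ln (\prod_(i <- r | P i) F i) = \sum_(i <- r | P i) ln (F i).
Proof.
move=> F0; elim: r => [|i r IH]; first by rewrite !big_nil ln1.
rewrite !big_cons; case: ifP => // Pi; rewrite lnM ?IH // posrE ?F0 //.
exact: prodr_gt0.
Qed.

Lemma sum_leq_nat k : (k < B)%N -> \sum_(1 <= j < B) ((j <= k)%N%:R : R) = k%:R.
Proof.
move=> kB; rewrite -natr_sum; congr (_%:R).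
rewrite (@big_cat_nat _ _ _ k.+1) //= big_nat (eq_bigr (fun=> 1%N)); last first.
  by move=> i /andP[_]; rewrite ltnS => ->.
rewrite -big_nat sum_nat_const_nat muln1 subn1 /= [X in (_ + X)%N]big_nat big1 ?addn0 //.
by move=> i /andP[ki _]; rewrite leqNgt ki.
Qed.

(** Shared by three products: [e] is [logn] for an integer n, [trunc_log] for lcm(1, ..., n), and an
    exponent supported at 3 for the residue class 0. *)
Lemma ln_prod_primes (e : nat -> nat) (F : nat -> bool) :
  (forall p, prime p -> (e p < B)%N) ->
  (forall p j, prime p -> (0 < j)%N -> F (p ^ j)%N = (j <= e p)%N) ->
  ln ((\prod_(p < B | prime p) p ^ e p)%N%:R : R) = ppsum (fun q => (F q)%:R).
Proof.
move=> eB FE; rewrite natr_prod ln_prod; last first.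
  by move=> p pp; rewrite ltr0n expn_gt0 prime_gt0.
apply: eq_bigr => p pp; rewrite natrX lnXn ?ltr0n ?prime_gt0 // -[LHS]mulr_natr.
rewrite -(sum_leq_nat (eB _ pp)) mulr_sumr !big_nat; apply: eq_bigr => j /andP[j0 _].
by rewrite FE.
Qed.

Lemma ln_dvdn n : (0 < n < B)%N -> ln (n%:R : R) = ppsum (fun q => (q %| n)%:R).
Proof.
move=> /andP[n0 nB].
rewrite -(@ln_prod_primes (logn^~ n)); last 2 first.
- by move=> p pp; rewrite (leq_trans _ nB) // ltnS ltnW // ltn_logl.
- by move=> p j pp j0; rewrite pfactor_dvdn.
congr (ln _%:R); rewrite -{1}(partnT n0) (@widen_partn B.-1); last by lia.
have -> : B.-1.+1 = B by lia.
rewrite big_mkord big_mkcond [RHS]big_mkcond; apply: eq_bigr => p _ /=.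
by case: ifP => // np; rewrite lognE np.
Qed.

Lemma sum_ln_ppsum (a : nat -> R) x : (x < B)%N ->
  \sum_(1 <= n < x.+1) a n * ln (n%:R : R) =
  ppsum (fun q => \sum_(1 <= n < x.+1) a n * (q %| n)%:R).
Proof.
move=> xB; rewrite ppsum_sum !big_nat; apply: eq_bigr => n /andP[n1 nx].
by rewrite ln_dvdn ?ppsumZ // n1 (leq_trans nx).
Qed.

Lemma sum_dvdn q x : (0 < q)%N -> (\sum_(1 <= n < x.+1) (q %| n) = x %/ q)%N.
Proof.
move=> q0; elim: x => [|x IH]; first by rewrite big_geq ?div0n.
by rewrite big_nat_recr //= IH divnS // addnC.
Qed.

Lemma ln_fact x : (x < B)%N ->
  ln (x`!%:R : R) = ppsum (fun q => (x %/ q)%:R).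
Proof.
move=> xB; rewrite fact_prod natr_prod big_nat ln_prod; last first.
  by move=> i /andP[i0 _]; rewrite ltr0n.
rewrite -big_nat (eq_bigr (fun n => 1 * ln (n%:R : R))); last by move=> *; rewrite mul1r.
rewrite sum_ln_ppsum //; apply: eq_ppsum => p j pp j0.
rewrite -(@sum_dvdn (p ^ j)) ?expn_gt0 ?prime_gt0 // natr_sum.
by apply: eq_bigr => *; rewrite mul1r.
Qed.

(** Legendre's formula for (2m)! / (m!)^2: the difference between 2m %/ q and twice m %/ q is the
    parity of 2m %/ q. *)
Lemma ln_central_bin m : (m.*2 < B)%N ->
  ln ('C(m.*2, m)%:R : R) = ppsum (fun q => (odd (m.*2 %/ q))%:R).
Proof.
move=> mB; have := bin_fact (leq_addr m m); rewrite addnn -addnn addnK addnn => E.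
have -> : ln ('C(m.*2, m)%:R : R) = ln ((m.*2)`!%:R) + (- 2) * ln (m`!%:R).
  rewrite -E !natrM !lnM ?posrE ?ltr0n ?mulr_gt0 ?ltr0n ?fact_gt0 ?bin_gt0 //; first by lra.
  by rewrite -addnn leq_addr.
rewrite !ln_fact -?ppsumZ -?ppsumD //; last by lia.
apply: eq_ppsum => p j pp j0; set q := (p ^ j)%N.
have q0 : (0 < q)%N by rewrite expn_gt0 prime_gt0.
have -> : (m %/ q = (m.*2 %/ q)./2)%N.
  by rewrite -!divn2 -divnMA mulnC divnMA -muln2 mulnK.
move: (m.*2 %/ q)%N => k; have /(congr1 (fun i => i%:R : R)) := odd_double_half k.
by rewrite natrD -mul2n natrM; lra.
Qed.

(** * Chebyshev's function, for all prime powers and by residue class modulo 3 *)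

Definition psi_all x := ppsum (fun q => (q <= x)%N%:R).
(** The residue is that of the prime power, not of the underlying prime. *)
Definition psi_mod a x := ppsum (fun q => ((q <= x) && (q %% 3 == a))%N%:R).

Lemma psi_mod_ge0 a x : 0 <= psi_mod a x.
Proof.
rewrite -[leLHS](_ : ppsum (fun=> 0) = 0); last first.
  by rewrite /ppsum big1 // => p _; rewrite big1 // => j _; rewrite mulr0.
by apply: ler_ppsum.
Qed.

Lemma psi_all_mod x : psi_all x = psi_mod 0 x + psi_mod 1 x + psi_mod 2 x.
Proof.
rewrite -!ppsumD; apply: eq_ppsum => p j _ _; case: (p ^ j <= x)%N => /=; last by rewrite !addr0.
by have := ltn_pmod (p ^ j)%N (isT : 0 < 3)%N; case: (_ %% _)%N => [|[|[|k]]] //= _;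
  rewrite !(addr0, add0r).
Qed.

Lemma ler_psi_all x y : (x <= y)%N -> psi_all x <= psi_all y.
Proof.
move=> xy; apply: ler_ppsum => p j _ _; rewrite ler_nat.
by case: (leqP (p ^ j) x) => // pj; rewrite (leq_trans pj xy).
Qed.

(** For m < q <= 2m the quotient 2m %/ q is 1, hence odd, so the central binomial coefficient
    accounts for all of these q. *)
Lemma psi_all_step m : (m.*2 < B)%N -> psi_all m.*2 <= psi_all m + ln ('C(m.*2, m)%:R : R).
Proof.
move=> mB; rewrite ln_central_bin // -ppsumD; apply: ler_ppsum => p j pp j0.
set q := (p ^ j)%N; have q0 : (0 < q)%N by rewrite expn_gt0 prime_gt0.
rewrite -natrD ler_nat; have [qm|qm] := leqP q m; first by rewrite (leq_trans (leq_b1 _)) ?leq_addr.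
have [qm2|//] := leqP q m.*2.
suff -> : (m.*2 %/ q = 1)%N by [].
have := divn_eq m.*2 q; have := ltn_pmod m.*2 q0.
have : (0 < m.*2 %/ q)%N by rewrite divn_gt0.
case: (_ %/ _)%N => [//|[//|k]] _; nia.
Qed.

Lemma ln_central_bin_psi m : (m.*2 < B)%N -> ln ('C(m.*2, m)%:R : R) <= psi_all m.*2.
Proof.
move=> mB; rewrite ln_central_bin //; apply: ler_ppsum => p j pp j0; rewrite ler_nat.
by have [le|lt] := leqP (p ^ j) m.*2; [exact: leq_b1|rewrite divn_small].
Qed.


(** The prime powers divisible by 3 are the powers of 3, and their weights add up to the logarithm
    of the largest one below x. *)
Lemma psi_mod0_le x : (0 < x)%N -> (x < B)%N -> psi_mod 0 x <= ln (x%:R : R).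
Proof.
move=> x0 xB; set e := fun p => if p == 3%N then trunc_log 3 x else 0%N.
have tB : (trunc_log 3 x < B)%N.
  by apply: leq_ltn_trans xB; rewrite (leq_trans (ltnW (ltn_expl _ _)) (trunc_logP _ x0)).
rewrite /psi_mod -(@ln_prod_primes e) /e.
- rewrite ler_ln ?posrE ?ltr0n //; last first.
    by apply: prodn_cond_gt0 => p pp; rewrite expn_gt0 prime_gt0.
  rewrite ler_nat; case: (ltnP 3 B) => B3.
    rewrite (bigD1 (Ordinal B3)) //= big1 ?muln1 ?trunc_logP // => p /andP[_].
    by rewrite -val_eqE /= => /negbTE ->.
  rewrite big1 // => p _; case: eqP => // p3; have := ltn_ord p; lia.
- by move=> p _; case: ifP => // _; lia.
move=> p j pp j0; rewrite -/(dvdn 3 (p ^ j)) Euclid_dvdX // j0 andbT dvdn_prime2 // eq_sym.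
case: eqP => [->|_]; last by rewrite andbF leqn0 gtn_eqF.
rewrite andbT; apply/idP/idP; first exact: trunc_log_max.
by move=> jt; rewrite (leq_trans _ (trunc_logP (isT : 1 < 3)%N x0)) ?leq_exp2l.
Qed.

(** * The nontrivial character modulo 3 and the class 2 *)

Definition chi3 (n : nat) : R := (n %% 3 == 1)%N%:R - (n %% 3 == 2)%N%:R.

Lemma sum_chi3 y : \sum_(1 <= n < y.+1) chi3 n = (y %% 3 == 1)%N%:R.
Proof.
elim: y => [|y IH]; first by rewrite big_geq.
rewrite big_nat_recr //= IH /chi3.
have [E|] : (y %% 3 = 0 /\ y.+1 %% 3 = 1 \/ y %% 3 = 1 /\ y.+1 %% 3 = 2 \/
             y %% 3 = 2 /\ y.+1 %% 3 = 0)%N by lia.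
  by case: E => -> ->; rewrite /=; lra.
by case=> -[-> ->] /=; lra.
Qed.

Lemma chi3M m n : chi3 (m * n) = chi3 m * chi3 n.
Proof.
rewrite /chi3 -modnMm.
have := ltn_pmod m (isT : 0 < 3)%N; have := ltn_pmod n (isT : 0 < 3)%N.
by case: (m %% 3)%N => [|[|[|]]] //; case: (n %% 3)%N => [|[|[|]]] //= _ _;
  rewrite ?modn_small //=; lra.
Qed.

(** The multiples of q are the n = q k, and the character is multiplicative: what remains is its
    partial sum up to x %/ q. *)
Lemma sum_chi3_dvdn q x : (0 < q)%N ->
  \sum_(1 <= n < x.+1) chi3 n * (q %| n)%:R = chi3 q * ((x %/ q) %% 3 == 1)%N%:R.
Proof.
move=> q0; rewrite -sum_chi3; elim: x => [|x IH].
  by rewrite div0n !big_geq // mulr0.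
rewrite big_nat_recr //= IH divnS //; case: (boolP (q %| x.+1)%N) => qx /=.
  rewrite add1n [in RHS]big_nat_recr //= mulrDr mulr1; congr (_ + _).
  have -> : (x %/ q).+1 = (x.+1 %/ q)%N by rewrite divnS // qx add1n.
  by rewrite -chi3M mulnC divnK.
by rewrite mulr0 addr0 add0n.
Qed.

(** A full block of three contributes ln (3k+1) - ln (3k+2) <= 0, so only an incomplete last block
    can make the sum positive. *)
Lemma sum_chi3_ln x : (0 < x)%N ->
  \sum_(1 <= n < x.+1) chi3 n * ln (n%:R : R) <= ln (x%:R : R).
Proof.
move=> x0.
have lnS n : (0 < n)%N -> ln (n%:R : R) <= ln (n.+1%:R : R).
  by move=> n0; rewrite ler_ln ?posrE ?ltr0n // ler_nat.
pose E y := \sum_(1 <= n < y.+1) chi3 n * ln (n%:R : R).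
have ES y : E y.+1 = E y + chi3 y.+1 * ln (y.+1%:R : R) by rewrite /E big_nat_recr.
have c0 k : chi3 (k * 3) = 0 by rewrite /chi3 modnMl subrr.
have c1 k : chi3 (k * 3).+1 = 1 by rewrite /chi3 -addn1 modnMDl /= subr0.
have c2 k : chi3 (k * 3).+2 = -1 by rewrite /chi3 -addn2 modnMDl /= sub0r.
have E3 k : E (k * 3)%N <= 0.
  elim: k => [|k IH]; first by rewrite /E big_geq.
  rewrite mulSn !addSn add0n !ES c1 c2.
  have -> : (k * 3).+3 = (k.+1 * 3)%N by rewrite mulSn.
  by rewrite c0; have := lnS (k * 3).+1 isT; lra.
rewrite -/(E x) (divn_eq x 3); have := ltn_pmod x (isT : 0 < 3)%N.
move: (x %/ 3)%N (E3 (x %/ 3)%N) => k Ek.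
case: (x %% 3)%N => [|[|[|]]] // _.
- by rewrite addn0 (le_trans Ek) // ln_natr_ge0.
- by rewrite addn1 ES c1; lra.
rewrite addn2 !ES c1 c2; have := lnS (k * 3).+1 isT; have := ln_natr_ge0 (k * 3).+2; lra.
Qed.

(* The summatory function of the character takes the values 0 and 1, and it is 1 on [1, 2[. *)
Lemma psi_mod1_half x : (0 < x < B)%N ->
  psi_mod 1 x <= psi_mod 1 x./2 + psi_mod 2 x + ln (x%:R : R).
Proof.
move=> /andP[x0 xB]; apply: le_trans (lerD (lexx _) (sum_chi3_ln x0)).
rewrite sum_ln_ppsum // -!ppsumD; apply: ler_ppsum => p j pp j0; set q := (p ^ j)%N.
have q0 : (0 < q)%N by rewrite expn_gt0 prime_gt0.
rewrite sum_chi3_dvdn // /chi3; have := ltn_pmod q (isT : 0 < 3)%N.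
case: (q %% 3)%N => [|[|[|]]] //= _; rewrite !(andbF, andbT) /=; first by lra.
  have [qx2|qx2] := leqP q x./2.
    by case: (q <= x)%N => /=; case: (_ == _) => /=; lra.
  have [qx|qx] := leqP q x; last by case: (_ == _) => /=; lra.
  suff -> : (x %/ q = 1)%N by rewrite /=; lra.
  have := divn_eq x q; have := ltn_pmod x q0.
  have : (0 < x %/ q)%N by rewrite divn_gt0.
  case: (_ %/ _)%N => [//|[//|k]] _; nia.
have [qx|qx] := leqP q x; first by case: (_ == _) => /=; lra.
by rewrite divn_small //=; lra.
Qed.

Lemma psi_mod1_iter k x : (0 < x < B)%N ->
  psi_mod 1 x <= psi_mod 1 (iter k half x) + k%:R * (psi_mod 2 x + ln (x%:R : R)).
Proof.
move=> xB; have [x0 _] := andP xB.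
elim: k => [|k IH]; first by rewrite mul0r addr0.
apply: (le_trans IH); rewrite iterS; set y := iter k half x.
have yx : (y <= x)%N by rewrite /y; elim: (k) => //= i; lia.
suff : psi_mod 1 y <= psi_mod 1 y./2 + psi_mod 2 x + ln (x%:R : R).
  by rewrite -natr1; nra.
have [->|y0] := posnP y.
  by rewrite /= -!addrA lerDl addr_ge0 ?psi_mod_ge0 ?ln_natr_ge0.
apply: (le_trans (psi_mod1_half _)); first by rewrite y0; lia.
rewrite -!addrA lerD2l lerD //; last by rewrite ler_ln ?posrE ?ltr0n ?ler_nat.
by apply: ler_ppsum => p j _ _; rewrite ler_nat; case: (leqP (p ^ j) y) => // /leq_trans ->.
Qed.

Lemma ln2_le1 : ln (2 : R) <= 1.
Proof. by have := @le_ln1Dx R 1; rewrite (_ : 1 + 1 = 2); [apply; lra|lra]. Qed.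

Lemma ln2_ge : 2^-1 <= ln (2 : R).
Proof.
have : ln (2^-1 : R) <= 2^-1 - 1.
  rewrite -[X in ln X](_ : 1 + (2^-1 - 1) = _); [apply: le_ln1Dx|]; lra.
by rewrite lnV ?posrE //; lra.
Qed.

Lemma leq_central_bin m : ('C(m.*2, m) <= 2 ^ m.*2)%N.
Proof.
rewrite (Pascal 1 1 m.*2 : (2 ^ m.*2)%N = _) (bigD1 (inord m : 'I_m.*2.+1)) //= inordK; last by lia.
by rewrite !exp1n !muln1 leq_addr.
Qed.

Lemma central_bin_ge m : (2 ^ m <= 'C(m.*2, m))%N.
Proof.
elim: m => // m IH; rewrite expnS mul2n -addnn -[X in (_ <= X)%N]/('C(m.*2.+2, m.+1)) binS.
rewrite (leq_trans (leq_add IH IH)) // leq_add //; first by rewrite binS leq_addl.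
by rewrite leq_bin2l.
Qed.

(** Induction through m = ceil(x/2): the bound at m and the binomial coefficient give 6m + 2m = 8m,
    which is at most 6x once x >= 2. *)
Lemma psi_all_ub x : (x.*2 < B)%N -> psi_all x <= 6 * x%:R.
Proof.
have [n] := ubnP x; elim: n x => // n IH [|[|x]] xn xB.
- rewrite mulr0 /psi_all -[leRHS](_ : ppsum (fun=> 0) = 0); last first.
    by rewrite /ppsum big1 // => p _; rewrite big1 // => j _; rewrite mulr0.
  by apply: ler_ppsum => p j pp _; rewrite leqNgt expn_gt0 prime_gt0.
- rewrite /psi_all -[leRHS]mulr1 (le_trans (_ : _ <= ppsum (fun=> 0))) //; last first.
    by rewrite /ppsum big1 // => p _; rewrite big1 // => j _; rewrite mulr0.
  apply: ler_ppsum => p j pp j0; rewrite leqNgt.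
  by rewrite -{1}(exp1n j) ltn_exp2r ?prime_gt1.
pose m := x.+3./2.
have mx : (x.+2 <= m.*2)%N by rewrite /m; lia.
have mB : (m.*2 < B)%N by rewrite /m; lia.
apply: (le_trans (ler_psi_all mx)); apply: (le_trans (psi_all_step mB)).
have IHm : psi_all m <= 6 * m%:R by apply: IH; rewrite /m; lia.
have lnb : ln ('C(m.*2, m)%:R : R) <= m.*2%:R.
  rewrite (@le_trans _ _ (ln ((2 ^ m.*2)%N%:R : R))) //.
    rewrite ler_ln ?posrE ?ltr0n ?expn_gt0 ?bin_gt0 -?addnn ?leq_addr //.
    by rewrite ler_nat addnn leq_central_bin.
  by rewrite natrX lnXn // -[leLHS]mulr_natl ler_piMr // ln2_le1.
have mx2 : (8 * m <= 6 * x.+2)%N by rewrite /m; lia.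
have : 8 * m%:R <= 6 * x.+2%:R :> R by rewrite -!natrM ler_nat.
have E : m.*2%:R = 2 * m%:R :> R by rewrite -mul2n natrM.
by move: IHm lnb; rewrite E; lra.
Qed.

Lemma psi_all_lb m : (m.*2 < B)%N -> m%:R / 2 <= psi_all m.*2.
Proof.
move=> mB; apply: le_trans (ln_central_bin_psi mB).
rewrite (@le_trans _ _ (ln ((2 ^ m)%N%:R : R))) //.
  by rewrite natrX lnXn // -[leRHS]mulr_natl ler_wpM2l // ln2_ge.
rewrite ler_ln ?posrE ?ltr0n ?expn_gt0 ?bin_gt0 -?addnn ?leq_addr //.
by rewrite ler_nat addnn central_bin_ge.
Qed.

Lemma ln_ge_lin_aux x : (0 < x)%N -> ln (x%:R : R) <= x%:R / 128 + 128.
Proof.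
move=> x0; have x0R : 0 < x%:R :> R by rewrite ltr0n.
have : ln (x%:R / 128 : R) < x%:R / 128 by apply: ln_sublinear; rewrite divr_gt0.
have : ln (128 : R) < 128 by apply: ln_sublinear.
by rewrite ln_div ?posrE //; lra.
Qed.

Lemma psi_mod2_lb x : (0 < x)%N -> (x.*2 < B)%N -> x%:R / 128 - 200 <= psi_mod 2 x.
Proof.
move=> x0 xB2; have xB : (0 < x < B)%N by lia.
(* Six halvings leave for the class 1 a remainder of at most 6x/64, well below the lower bound (x -
   1)/4 for all classes together. This gives 7 psi_mod 2 x >= 5x/32 - 7 ln x - 1/4. *)
have := psi_mod1_iter 6 xB; set y := iter 6 half x => it.
have yx : (64 * y <= x)%N by rewrite /y /=; lia.
have y1 : psi_mod 1 y <= 6 * y%:R.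
  apply: le_trans (_ : psi_all y <= _); last by apply: psi_all_ub; lia.
  by apply: ler_ppsum => p j _ _; rewrite ler_nat; case: (_ <= y)%N => //=; case: eqP.
have yR : 64 * y%:R <= x%:R :> R by rewrite -natrM ler_nat.
have lb : (x%:R - 1) / 4 <= psi_all x.
  apply: le_trans (ler_psi_all (_ : x./2.*2 <= x)%N); last by lia.
  apply: le_trans (psi_all_lb _); last by lia.
  have : (x <= x./2.*2 + 1)%N by lia.
  by rewrite -(ler_nat R) natrD -mul2n natrM; lra.
have := psi_mod0_le x0 (proj2 (andP xB)); have := ln_ge_lin_aux x0.
have xR : 0 <= x%:R :> R by [].
by rewrite psi_all_mod in lb; lra.
Qed.

End PrimePowerSums.

(** Each q counted by [psi_mod 2 x] divides D, and the weights of the prime powers dividing D add up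
    to ln D. *)
Theorem chebyshev_mod3 (R : realType) (D x : nat) : (0 < D)%N -> (0 < x)%N ->
  (forall p j, prime p -> (0 < j)%N -> (p ^ j <= x)%N -> (p ^ j %% 3 = 2)%N ->
     (p ^ j %| D)%N) ->
  x%:R / 128 - 200 <= ln (D%:R : R).
Proof.
move=> D0 x0 qD; pose B := (x.*2 + D).+1.
have DB : (0 < D < B)%N by rewrite D0 /B; lia.
apply: (le_trans (psi_mod2_lb (B := B) _ x0 _)); first by rewrite /B; lia.
rewrite (ln_dvdn R DB); apply: ler_ppsum => p j pp j0; rewrite ler_nat.
by case: andP => // -[qx /eqP q2]; rewrite qD.
Qed.

(** The witness is lcm(1, ..., n), whose logarithm is [psi_all n]. *)
Theorem small_common_multiple (R : realType) (n : nat) : (0 < n)%N ->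
  exists L, [/\ (0 < L)%N, forall i, (0 < i <= n)%N -> (i %| L)%N
                & ln (L%:R : R) <= 6 * n%:R].
Proof.
move=> n0; pose B := n.*2.+1; exists (\prod_(p < B | prime p) p ^ trunc_log p n)%N.
have tB p : prime p -> (trunc_log p n < B)%N.
  move=> pp; have := trunc_logP (prime_gt1 pp) n0.
  have := ltn_expl (trunc_log p n) (prime_gt1 pp); rewrite /B; lia.
split.
- by apply: prodn_cond_gt0 => p pp; rewrite expn_gt0 prime_gt0.
- move=> i /andP[i0 iB]; rewrite -{1}(partnT i0) (@widen_partn n.*2) ?big_mkord; last by lia.
  rewrite big_mkcond [X in (_ %| X)%N]big_mkcond.
  apply: (big_ind2 dvdn) => // [*|p _]; first exact: dvdn_mul.
  case: ifP => [pp|np]; last by rewrite lognE np.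
  rewrite dvdn_exp2l // trunc_log_max ?prime_gt1 //.
  by apply: leq_trans iB; apply: dvdn_leq => //; exact: pfactor_dvdnn.
rewrite (ln_prod_primes (B := B) R tB (F := fun q => (q <= n)%N)).
  exact: psi_all_ub.
move=> p j pp j0; apply/idP/idP => [|jt]; first by apply: trunc_log_max; rewrite prime_gt1.
by apply: leq_trans (trunc_logP (prime_gt1 pp) n0); rewrite leq_exp2l ?prime_gt1.
Qed.

(** * The order Z[X]/(X^d - 3), on the basis of the powers of X *)

Section PureExtension.
Variable d' : nat.
Local Notation d := d'.+1.

(** The entry (a, b) is the coefficient of X^i in X^(a+b), reduced by X^d = 3. These Gram matrices
    of the coordinates of the product become the blocks of the commutator form. *)
Definition struct_mx (i : 'I_d) : 'M[int]_d :=
  \matrix_(a, b) ((a + b == i)%N%:R + 3 * (a + b == i + d)%N%:R).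

Definition mul_mx_of (x : 'cV[int]_d) : 'M[int]_d :=
  \matrix_(i, b) \sum_a x a 0 * struct_mx i a b.

Definition omul (x y : 'cV[int]_d) : 'cV[int]_d := mul_mx_of x *m y.

Lemma omulE x y i : omul x y i 0 = (x^T *m struct_mx i *m y) 0 0.
Proof.
rewrite !mxE; apply: eq_bigr => b _; rewrite !mxE; congr (_ * _).
by apply: eq_bigr => a _; rewrite !mxE.
Qed.

Lemma struct_mx_sym i : (struct_mx i)^T = struct_mx i.
Proof. by apply/matrixP => a b; rewrite !mxE addnC. Qed.

Lemma omulC x y : omul x y = omul y x.
Proof.
apply/colP => i; rewrite !omulE.
have -> : y^T *m struct_mx i *m x = (x^T *m struct_mx i *m y)^T.
  by rewrite !trmx_mul trmxK struct_mx_sym mulmxA.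
by rewrite [RHS]mxE.
Qed.

Lemma omulNr x y : omul x (- y) = - omul x y.
Proof. exact: mulmxN. Qed.

Lemma omulNl x y : omul (- x) y = - omul x y.
Proof. by rewrite omulC omulNr omulC. Qed.

Lemma omulZl a x y : omul (a *: x) y = a *: omul x y.
Proof. by rewrite omulC /omul -scalemxAr -/(omul y x) omulC. Qed.

Lemma omul1l y : omul (delta_mx 0 0) y = y.
Proof.
rewrite /omul (_ : mul_mx_of _ = 1%:M) ?mul1mx //; apply/matrixP => i b.
rewrite !mxE (bigD1 0) //= big1 ?addr0.
  rewrite !mxE eqxx mul1r /= add0n.
  have -> : (b == i + d :> nat)%N = false by apply/negbTE; have := ltn_ord b; lia.
  by rewrite mulr0 addr0 eq_sym.
by move=> a /negbTE a0; rewrite mxE a0 mul0r.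
Qed.

Section Evaluation.
Variables (T : comNzRingType) (t : T).

(** A ring morphism from the order once t^d = 3; it is applied to the roots of X^d - 3 in closed
    fields and to roots in Z/q. *)
Definition oeval (x : 'cV[int]_d) : T := \sum_i (x i 0)%:~R * t ^+ i.

Lemma oevalD x y : oeval (x + y) = oeval x + oeval y.
Proof. by rewrite -big_split; apply: eq_bigr => i _; rewrite mxE intrD mulrDl. Qed.

Lemma oevalN x : oeval (- x) = - oeval x.
Proof. by rewrite -sumrN; apply: eq_bigr => i _; rewrite mxE rmorphN mulNr. Qed.

Hypothesis td : t ^+ d = 3.

Lemma oeval_struct a b : \sum_(i < d) (struct_mx i a b)%:~R * t ^+ i = t ^+ (a + b).
Proof.
have [abd|dab] := ltnP (a + b) d.
  rewrite (bigD1 (Ordinal abd)) //= big1 ?addr0; last first.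
    move=> i; rewrite -val_eqE /= => iab; rewrite mxE eq_sym (negbTE iab).
    by rewrite ltn_eqF ?mulr0 ?addr0 ?mul0r // (leq_trans abd) ?leq_addl.
  by rewrite mxE /= eqxx ltn_eqF ?mulr0 ?addr0 ?mul1r // (leq_trans abd) ?leq_addl.
have abd : (a + b - d < d)%N by have := ltn_ord a; have := ltn_ord b; lia.
rewrite (bigD1 (Ordinal abd)) //= big1 ?addr0; last first.
  move=> i; rewrite -val_eqE /= => iab; rewrite mxE.
  rewrite [(a + b == i)%N]gtn_eqF ?(leq_trans (ltn_ord i)) //.
  by rewrite [(_ == i + d)%N](_ : _ = false) ?mulr0 ?mul0r //; apply/negbTE; lia.
rewrite mxE /= subnK // eqxx [(a + b == _)%N]gtn_eqF; last by lia.
by rewrite add0r mulr1 -[in RHS](subnK dab) exprD td mulrC.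
Qed.

(** The row of the powers of t is a left eigenvector of multiplication by x, for the eigenvalue
    [oeval x]. *)
Lemma oeval_mul_mx x (b : 'I_d) :
  \sum_(i < d) t ^+ i * (mul_mx_of x i b)%:~R = oeval x * t ^+ b.
Proof.
rewrite mulr_suml (eq_bigr (fun i : 'I_d => \sum_a (x a 0)%:~R * ((struct_mx i a b)%:~R * t ^+ i))).
  rewrite exchange_big; apply: eq_bigr => a _ /=.
  by rewrite -mulr_sumr oeval_struct exprD mulrA.
move=> i _; rewrite mxE rmorph_sum mulr_sumr; apply: eq_bigr => a _.
by rewrite rmorphM /= mulrC mulrA.
Qed.

Lemma oevalM x y : oeval (omul x y) = oeval x * oeval y.
Proof.
rewrite {1}/oeval (eq_bigr (fun i : 'I_d => \sum_b (y b 0)%:~R * (t ^+ i * (mul_mx_of x i b)%:~R))).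
  rewrite exchange_big mulr_sumr; apply: eq_bigr => b _ /=.
  by rewrite -mulr_sumr oeval_mul_mx mulrCA.
move=> i _; rewrite mxE rmorph_sum mulr_suml; apply: eq_bigr => b _.
by rewrite rmorphM /=; ring.
Qed.

(** The eigenvector has first entry 1, so multiplying by the adjugate isolates the determinant; this
    works over rings with zero divisors such as Z/q. *)
Lemma oeval_det x : oeval x = 0 -> (\det (mul_mx_of x))%:~R = 0 :> T.
Proof.
move=> x0; pose v : 'rV[T]_d := \row_i t ^+ i.
have v0 : v *m map_mx intr (mul_mx_of x) = 0.
  apply/rowP => b; rewrite !mxE; transitivity (oeval x * t ^+ b); last by rewrite x0 mul0r.
  by rewrite -oeval_mul_mx; apply: eq_bigr => i _; rewrite !mxE.
have := congr1 (fun A => (A *m \adj (map_mx intr (mul_mx_of x))) 0 0) v0.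
by rewrite -mulmxA mul_mx_adj mul0mx mul_mx_scalar !mxE det_map_mx expr0 mulr1.
Qed.

End Evaluation.

Lemma irreducible_Xn_sub3 : irreducible_poly ('X^d - 3%:P : {poly rat}).
Proof.
have -> : 'X^d - 3%:P = map_poly intr ('X^d - 3%:P : {poly int}) :> {poly rat}.
  by rewrite rmorphB /= map_polyXn map_polyC.
apply/irreducible_rat_int/(@eisenstein_crit 3) => //; rewrite ?size_XnsubC ?lead_coefXnsubC //.
  by rewrite coefB coefXn coefC.
by move=> [_|i id]; rewrite coefB coefXn coefC //= ltn_eqF.
Qed.

Section Roots.
Variable C : numClosedFieldType.

(** X^d - 3 is irreducible over Q and the polynomial of x has degree below d; unless it is zero, the
    two are coprime and share no root. *)
Lemma oeval_eq0 (t : C) x : t ^+ d = 3 -> oeval t x = 0 -> x = 0.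
Proof.
move=> td x0; pose P : {poly rat} := rVpoly (map_mx intr x^T).
have Pt : root (map_poly ratr P) t.
  apply/eqP; rewrite -x0 (@horner_coef_wide _ d) ?size_map_poly ?size_poly //.
  by apply: eq_bigr => i _; rewrite coef_map coef_rVpoly_ord !mxE /= ratr_int.
have Ft : root (map_poly ratr ('X^d - 3%:P : {poly rat})) t.
  by rewrite /root rmorphB /= map_polyXn map_polyC /= !hornerE td rmorph_nat subrr.
have [P0|P0] := eqVneq P 0.
  apply/colP => i; have := coef_rVpoly_ord (map_mx intr x^T : 'rV[rat]_d) i.
  by rewrite -/P P0 coef0 !mxE => /esym/eqP; rewrite intr_eq0 => /eqP.
have /coprimep_root/(_ Pt) : coprimep (map_poly ratr P) (map_poly (@ratr C) ('X^d - 3%:P)).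
  rewrite coprimep_map /coprimep.
  case: (irredp_XsubCP irreducible_Xn_sub3 (dvdp_gcdr P _)).
    by move/eqp_size ->; rewrite size_poly1.
  move=> E; have := dvdp_gcdl P ('X^d - 3%:P); rewrite (eqp_dvdl _ E) => /dvdp_leq.
  by move=> /(_ P0); rewrite size_XnsubC // leqNgt ltnS size_poly.
by rewrite -rootE Ft.
Qed.

Lemma roots3 : exists r : 'I_d -> C, injective r /\ forall i, r i ^+ d = 3.
Proof.
pose F : {poly C} := 'X^d - 3%:P.
have mF : lead_coef F = 1 by rewrite lead_coefXnsubC.
have [s] := closed_field_poly_normal F; rewrite mF scale1r => Fs.
have us : uniq s.
  rewrite -separable_prod_XsubC -Fs unlock; apply/Bezout_coprimepP.
  (* With F = X^d - 3, the combination -d F + X F' is the nonzero constant 3d, so F is separable. *)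
  exists (- d%:R, 'X); rewrite /F /= derivB derivXn derivC subr0.
  have -> : - d%:R * ('X^d - 3%:P) + 'X * ('X^d' *+ d) = (3 * d)%N%:R%:P :> {poly C}.
    by rewrite mulrnAr -exprS -mulr_natl !rmorph_nat natrM; ring.
  by rewrite polyC_eqp1 pnatr_eq0.
have ss : size s = d.
  by apply: succn_inj; rewrite -(@size_prod_XsubC _ _ s id) -Fs size_XnsubC.
exists (fun i : 'I_d => s`_i); split=> [i j /eqP|i].
  by rewrite nth_uniq ?ss // => /eqP/val_inj.
have : root F s`_i by rewrite Fs root_prod_XsubC mem_nth ?ss.
by rewrite /root /F !hornerE subr_eq0 => /eqP.
Qed.

Lemma unit_Vandermonde (r : 'I_d -> C) : injective r ->
  \matrix_(i < d, j < d) r i ^+ j \in unitmx.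
Proof.
move=> rI; pose a : 'rV[C]_d := \row_i r i.
have -> : \matrix_(i < d, j < d) r i ^+ j = (Vandermonde d a)^T.
  by apply/matrixP => i j; rewrite !mxE.
rewrite unitmx_tr unitmxE det_Vandermonde unitfE.
apply/prodf_neq0 => i _; apply/prodf_neq0 => j ij; rewrite !mxE subr_eq0.
by apply: contraTneq ij => /rI ->; rewrite ltnn.
Qed.

End Roots.

(* The determinant is the norm, the product of the values at the conjugates of X. *)
Lemma det_mul_mx_neq0 x : x != 0 -> \det (mul_mx_of x) != 0.
Proof.
move=> x0; have [r [rI rd]] := roots3 algC.
pose V := \matrix_(i < d, j < d) r i ^+ j.
have VM : V *m map_mx intr (mul_mx_of x) = diag_mx (\row_i oeval (r i) x) *m V.
  apply/matrixP => i b; rewrite mul_diag_mx !mxE -oeval_mul_mx //.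
  by apply: eq_bigr => j _; rewrite !mxE.
have := congr1 determinant VM; rewrite !det_mulmx mulrC => /mulIf.
have := unit_Vandermonde rI; rewrite -/V unitmxE unitfE => -> /(_ isT).
rewrite det_diag det_map_mx => E; rewrite -(intr_eq0 algC) E.
apply/prodf_neq0 => i _; rewrite mxE; apply: contra_neq x0.
exact: oeval_eq0.
Qed.

Lemma omul_adj x z : omul x (\adj (mul_mx_of x) *m z) = \det (mul_mx_of x) *: z.
Proof. by rewrite /omul mulmxA mul_mx_adj mul_scalar_mx. Qed.

(** Leibniz's formula with entries at most 4 d M, the structure constants being at most 1 + 3. A
    norm polynomial in the coordinates is what makes the detecting moduli logarithmic. *)
Lemma norm_det_le (x : 'cV[int]_d) (M : int) :
  (forall a, `|x a 0| <= M) -> `|\det (mul_mx_of x)| <= d`!%:R * (4 * d%:R * M) ^+ d.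
Proof.
move=> xM; have M0 : 0 <= M by apply: le_trans (xM 0).
have eM i b : `|mul_mx_of x i b| <= 4 * d%:R * M.
  rewrite mxE (le_trans (ler_norm_sum _ _ _)) //.
  apply: (@le_trans _ _ (\sum_(a < d) 4 * M)); last first.
    by rewrite sumr_const card_ord -mulr_natr; lia.
  apply: ler_sum => a _; rewrite normrM mulrC ler_pM // mxE.
  by case: (_ == _); case: (_ == _).
rewrite /determinant (le_trans (ler_norm_sum _ _ _)) //.
rewrite -perm.card_Sn -sum1_card natr_sum mulr_suml.
apply: ler_sum => s _; rewrite normrM normr_sign !mul1r normr_prod.
rewrite -[X in _ ^+ X](card_ord d) -prodr_const; apply: ler_prod => i _.
by rewrite normr_ge0 eM.
Qed.

Lemma dvdn_det q (t : 'Z_q) x : (1 < q)%N -> t ^+ d = 3 -> oeval t x = 0 ->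
  (q %| `|\det (mul_mx_of x)|)%N.
Proof.
move=> q1 td /(oeval_det td); set D := \det _ => D0.
have : (absz D)%:R = 0 :> 'Z_q.
  by case: D D0 => n /=; rewrite ?NegzE // rmorphN => /eqP; rewrite oppr_eq0 => /eqP.
by move=> /(congr1 val); rewrite /= val_Zp_nat // => /eqP.
Qed.

End PureExtension.

(* Cubing is a bijection on the units modulo q, as 3 is coprime to totient q. *)
Lemma root3_mod (p j k : nat) : prime p -> (p ^ j %% 3 = 2)%N ->
  exists t : 'Z_(p ^ j), t ^+ (3 ^ k) = 3.
Proof.
move=> pp; set q := (p ^ j)%N => q2.
have j0 : (0 < j)%N by rewrite lt0n; apply/eqP => j0; move: q2; rewrite /q j0.
have q1 : (1 < q)%N by rewrite -(exp1n j) ltn_exp2r // prime_gt1.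
have c3q : coprime 3 q by rewrite prime_coprime // /dvdn q2.
(* If p were 0 or 1 modulo 3, so would be q. Hence 3 divides neither factor of totient q = (p - 1)
   p^(j-1). *)
have p3 : (p %% 3 = 2)%N.
  have p1 : (p %% 3 != 1)%N.
    by apply/eqP => p1; move: q2; rewrite /q -modnXm p1 exp1n.
  have p0 : (p %% 3 != 0)%N.
    by apply/eqP => p0; move: q2; rewrite /q -modnXm p0 exp0n.
  by move: (p %% 3)%N (ltn_pmod p (isT : 0 < 3)%N) p1 p0 => [|[|[|]]].
have c3t : coprime (3 ^ k) (totient q).
  rewrite coprimeXl // totient_pfactor // coprimeMr prime_coprime //.
  apply/andP; split; last by rewrite coprimeXr // prime_coprime // /dvdn p3.
  by rewrite /dvdn; have := prime_gt1 pp; lia.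
(* Here u inverts 3^k modulo totient q, so the root is 3^u, by Euler's theorem. *)
have [u v E _] := egcdnP (totient q) (expn_gt0 3 k : 0 < 3 ^ k)%N.
exists (3 ^ u)%N%:R; rewrite -natrX -expnM -(Zp_nat_mod q1) E (eqP c3t).
rewrite expnD expn1 [(v * _)%N]mulnC expnM -modnMml -modnXm (cyclic.Euler_exp_totient c3q).
by rewrite modnXm exp1n modnMml mul1n Zp_nat_mod.
Qed.

(** * Subgroups, indices and word norms *)

Section NatExtrema.
Implicit Types (A : set nat) (k b : nat).

Lemma natmin_spec A k : A k -> A (natmin A) /\ lbound A (natmin A).
Proof.
move=> Ak; suff /(xgetPex 0%N)[] : exists m, (A `&` lbound A) m by [].
have ex : exists m, `[< A m >] by exists k; exact/asboolP.
exists (ex_minn ex); case: ex_minnP => m /asboolP Am mmin; split=> // n An.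
by apply: mmin; exact/asboolP.
Qed.

Lemma natmin_le A k : A k -> (natmin A <= k)%N.
Proof. by move=> Ak; have [_] := natmin_spec Ak; exact. Qed.

Lemma natmin_in A k : A k -> A (natmin A).
Proof. by case/natmin_spec. Qed.

Lemma natmin_eq A k : A k -> lbound A k -> natmin A = k.
Proof.
move=> Ak Al; apply/eqP; rewrite eqn_leq natmin_le //=; exact: Al (natmin_in Ak).
Qed.

Lemma natmax_spec A k b : A k -> (forall n, A n -> (n <= b)%N) ->
  A (natmax A) /\ ubound A (natmax A).
Proof.
move=> Ak Ab; suff /(xgetPex 0%N)[] : exists m, (A `&` ubound A) m by [].
have ex : exists m, `[< A m >] by exists k; exact/asboolP.
have ub n : `[< A n >] -> (n <= b)%N by move/asboolP/Ab.
exists (ex_maxn ex ub); case: ex_maxnP => m /asboolP Am mmax; split=> // n An.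
by apply: mmax; exact/asboolP.
Qed.

Lemma natmax_ge A k b : (forall n, A n -> (n <= b)%N) -> A k -> (k <= natmax A)%N.
Proof. by move=> Ab Ak; have [_] := natmax_spec Ak Ab; exact. Qed.

Lemma natmin0 A : (forall k, ~ A k) -> natmin A = 0%N.
Proof. by move=> A0; rewrite /natmin xgetPN // => k [/A0]. Qed.

End NatExtrema.

Lemma card_setT_fin (T : finType) : ([set: T] #= `I_#|T|)%card.
Proof.
have <- : (fun x : T => val (enum_rank x)) @` [set: T] = `I_#|T|.
  apply/seteqP; split=> [_ [x _ <-] /=|k kT]; first exact: ltn_ord.
  by exists (enum_val (Ordinal kT)) => //; rewrite enum_valK.
by rewrite card_eq_sym; apply: inj_card_eq => x y _ _ /val_inj/enum_rank_inj.
Qed.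

Section Subgroups.
Local Open Scope group_scope.
Variable G : groupType.
Implicit Types (A H K N S : set G) (x y g : G).

Lemma is_subgroupV H x : is_subgroup H -> H x -> H x^-1.
Proof. by case=> H1 HF Hx; rewrite -[x^-1]mul1g; exact: HF. Qed.

Lemma is_subgroupM H x y : is_subgroup H -> H x -> H y -> H (x * y).
Proof.
move=> sH Hx Hy; rewrite -[y]invgK; apply: (proj2 sH) => //.
exact: is_subgroupV.
Qed.

Lemma is_subgroupX H x k : is_subgroup H -> H x -> H (x ^+ k).
Proof.
move=> sH Hx; elim: k => [|k IH]; first by rewrite expg0; case: sH.
by rewrite expgS; exact: is_subgroupM.
Qed.

Lemma generated_subgroup A : is_subgroup (generated A).
Proof.
split=> [H [[]] //|x y Ax Ay H HA].
by case: (HA) => -[_ HF] _; apply: HF; [apply: Ax|apply: Ay].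
Qed.

Lemma sub_generated A : A `<=` generated A.
Proof. by move=> x Ax H [_]; exact. Qed.

Lemma generated_min A H : is_subgroup H -> A `<=` H -> generated A `<=` H.
Proof. by move=> sH AH x; apply; split. Qed.

Lemma conj_in N x y : normal_in N [set: G] -> N x -> N (x ^ y).
Proof. by case=> _ _ _ + Nx; apply. Qed.

Lemma comm_in N x y : normal_in N [set: G] -> N x -> N [~ x, y].
Proof.
move=> nN Nx; rewrite commgEl; have [sN _ _ _] := nN.
by apply: is_subgroupM => //; [exact: is_subgroupV|exact: conj_in].
Qed.

(** Compatibility with a bare operation [op] makes the fibres of [F] the cosets of the fibre of 1.
    The Heisenberg group over Z/q thus enters only as a finite set of triples with a law. *)
Lemma kernel_index (T : finType) (F : G -> T) (op : T -> T -> T) :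
  (forall x y, F (x * y) = op (F x) (F y)) ->
  normal_in [set g | F g = F 1] [set: G] /\
  exists2 k, (k <= #|T|)%N & has_index [set: G] [set g | F g = F 1] k.
Proof.
move=> Fop.
have FL x y z : F x = F y -> F (z * x) = F (z * y) by rewrite !Fop => ->.
have FR x y z : F x = F y -> F (x * z) = F (y * z) by rewrite !Fop => ->.
have FE x y : F (x^-1 * y) = F 1 <-> F x = F y.
  split=> [/(FL _ _ x)|/(FL _ _ x^-1)]; last by rewrite mulVg => ->.
  by rewrite mulVKg mulg1.
split.
  split=> // [|k h /= Fk _].
    split=> //= x y Fx Fy; have /FE : F y = F 1 by [].
    by rewrite mulg1 => Fy'; rewrite (FR _ _ _ Fx) mul1g.
  by rewrite conjgE; apply/FE; rewrite (FR _ _ _ Fk) mul1g.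
have cosetE x : [set x * k | k in [set g | F g = F 1]] = F @^-1` [set F x].
  apply/seteqP; split=> [_ [k /= Fk <-]|y /= yx]; first by rewrite -[in RHS](mulg1 x); exact: FL.
  by exists (x^-1 * y); [apply/FE|rewrite mulVKg].
pose I := F @` [set: G].
have IL : (lcosets [set: G] [set g | F g = F 1] #= I)%card.
  have -> : lcosets [set: G] [set g | F g = F 1] = (fun t => F @^-1` [set t]) @` I.
    apply/seteqP; split=> [_ [x _ <-]|_ [_ [x _ <-] <-]].
      by rewrite cosetE; exists (F x) => //; exists x.
    by exists x => //; rewrite cosetE.
  apply: inj_card_eq => _ t /set_mem[x _ <-] _ /seteqP[xt _].
  exact: (xt x).
have /finite_setP[k Ik] : finite_set I by exact: finite_finset.
exists k; last exact: card_eq_trans IL Ik.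
rewrite -card_le_II -(card_le_eqr (card_setT_fin T)) -(card_le_eql Ik).
exact: subset_card_le.
Qed.

Lemma leq_index H N (T : finType) (f : T -> G) k : is_subgroup N ->
  has_index H N k -> (forall t, H (f t)) ->
  (forall s t, N ((f s)^-1 * f t) -> s = t) -> (#|T| <= k)%N.
Proof.
move=> [N1 _] Nk Hf fI; rewrite -card_le_II -(card_le_eql (card_setT_fin T)) -(card_le_eqr Nk).
pose c x := [set x * n | n in N].
have cI : {in [set: T] &, injective (c \o f)}.
  move=> s t _ _ /seteqP[_ /(_ (f t))] []; first by exists 1; rewrite ?mulg1.
  by move=> n Nn stn; apply: fI; rewrite -stn mulKg.
rewrite -(card_le_eql (inj_card_eq cI)); apply: subset_card_le => _ [t _ <-].
by exists (f t).
Qed.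

End Subgroups.

Section Words.
Local Open Scope group_scope.
Variables (G : groupType) (S : set G).
Implicit Types (g h : G).

Definition is_word (w : seq G) := forall x, x \in w -> S x \/ S x^-1.

Lemma word_norm_le w : is_word w -> (word_norm S (\prod_(x <- w) x) <= size w)%N.
Proof. by move=> Sw; apply: natmin_le; exists w. Qed.

Hypothesis genS : generates S.

Lemma word_normP g : exists w,
  [/\ is_word w, \prod_(x <- w) x = g & size w = word_norm S g].
Proof.
suff [w Sw wg] : exists2 w, is_word w & \prod_(x <- w) x = g.
  have /natmin_in : [set size w | w in [set w : seq G |
    (forall x, x \in w -> S x \/ S x^-1) /\ \prod_(x <- w) x = g]] (size w) by exists w.
  by case=> v [Sv vg] vs; exists v.
have : generated S g by rewrite genS.
apply: (generated_min (H := [set g | exists2 w, is_word w & \prod_(x <- w) x = g]));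
  last first.
  move=> x Sx; exists [:: x]; last by rewrite big_seq1.
  by move=> y; rewrite inE => /eqP ->; left.
split; first by exists [::]; rewrite ?big_nil.
move=> _ _ [v Sv <-] [w Sw <-]; exists (v ++ rev [seq x^-1 | x <- w]).
  move=> x; rewrite mem_cat mem_rev => /orP[/Sv //|/mapP[y /Sw yS ->]].
  by rewrite invgK; case: yS; [right|left].
rewrite big_cat /=; congr (_ * _); elim: (w) => [|y u IH]; first by rewrite !big_nil invg1.
by rewrite /= rev_cons -cats1 big_cat big_seq1 big_cons invgM -IH.
Qed.

Lemma word_normM g h : (word_norm S (g * h) <= word_norm S g + word_norm S h)%N.
Proof.
have [v [Sv <- <-]] := word_normP g; have [w [Sw <- <-]] := word_normP h.
rewrite -big_cat -size_cat; apply: word_norm_le => x.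
by rewrite mem_cat => /orP[/Sv|/Sw].
Qed.

Lemma word_normX g k : (word_norm S (g ^+ k) <= k * word_norm S g)%N.
Proof.
elim: k => [|k IH]; last by rewrite expgS mulSn (leq_trans (word_normM _ _)) // leq_add2l.
rewrite expg0 mul0n; have := @word_norm_le [::]; rewrite big_nil; exact.
Qed.

Lemma word_normV g : (word_norm S g^-1 <= word_norm S g)%N.
Proof.
have [w [Sw <- <-]] := word_normP g.
have -> : (\prod_(x <- w) x)^-1 = \prod_(x <- rev [seq x^-1 | x <- w]) x.
  elim: (w) => [|y u IH]; first by rewrite !big_nil invg1.
  by rewrite /= rev_cons -cats1 big_cat big_seq1 big_cons invgM -IH.
rewrite -(size_map (fun x => x^-1) w) -size_rev; apply: word_norm_le => x.
rewrite mem_rev => /mapP[y /Sw yS ->].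
by rewrite invgK; case: yS; [right|left].
Qed.

Lemma word_normR g h :
  (word_norm S [~ g, h] <= 2 * (word_norm S g + word_norm S h))%N.
Proof.
rewrite commgEl conjgE.
rewrite (leq_trans (word_normM _ _)) //.
have := word_normM h^-1 (g * h).
have := word_normM g h; have := word_normV g; have := word_normV h.
move: (word_norm S g^-1) (word_norm S h^-1) (word_norm S (g * h)) => a b c.
move: (word_norm S (h^-1 * (g * h))) (word_norm S g) (word_norm S h) => e x y; lia.
Qed.

End Words.

(** * The Heisenberg group over the order *)

Section Heisenberg.
Variable d' : nat.
Local Notation d := d'.+1.

Definition heis_mx (i : 'I_d) : 'M[int]_(d + d) :=
  block_mx 0 (struct_mx i) (- struct_mx i) 0.

Local Notation H := (Gphi heis_mx).

Definition hmk (x y z : 'cV[int]_d) : H := MkGphi heis_mx (col_mx x y, z).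
Definition hx (g : H) : 'cV[int]_d := usubmx (gphi_val g).1.
Definition hy (g : H) : 'cV[int]_d := dsubmx (gphi_val g).1.
Definition hz (g : H) : 'cV[int]_d := (gphi_val g).2.

Lemma hmkE g : hmk (hx g) (hy g) (hz g) = g.
Proof. by case: g => -[w v]; rewrite /hmk /hx /hy /hz /= vsubmxK. Qed.

Lemma hx_mk x y z : hx (hmk x y z) = x. Proof. exact: col_mxKu. Qed.
Lemma hy_mk x y z : hy (hmk x y z) = y. Proof. exact: col_mxKd. Qed.
Lemma hz_mk x y z : hz (hmk x y z) = z. Proof. by []. Qed.
Definition hmk_proj := (hx_mk, hy_mk, hz_mk).

Lemma form_heis w w' :
  Defs.form heis_mx w w' = omul (usubmx w) (dsubmx w') - omul (dsubmx w) (usubmx w').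
Proof.
apply/colP => i; rewrite mxE [RHS]mxE [X in _ = _ + X]mxE !omulE.
rewrite -{1}(vsubmxK w) -{1}(vsubmxK w') tr_col_mx mul_row_block !mulmx0 add0r addr0.
by rewrite mul_row_col mxE addrC mulmxN mulNmx [X in _ + X]mxE.
Qed.

Lemma lower_heis i : lower_part heis_mx i = block_mx 0 0 (- struct_mx i) 0.
Proof.
apply/matrixP => p q; rewrite mxE /heis_mx.
case: (split_ordP p) => a ->; case: (split_ordP q) => b -> /=;
  rewrite ?block_mxEul ?block_mxEur ?block_mxEdl ?block_mxEdr ?mxE ?if_same //.
  by rewrite ltnNge (leq_trans (ltnW (ltn_ord a))) ?leq_addr.
by rewrite (leq_trans (ltn_ord b)) ?leq_addr.
Qed.

Lemma formL_heis w w' : formL heis_mx w w' = - omul (dsubmx w) (usubmx w').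
Proof.
apply/colP => i; rewrite mxE [RHS]mxE omulE lower_heis.
rewrite -{1}(vsubmxK w) -{1}(vsubmxK w') tr_col_mx mul_row_block !mulmx0 !add0r.
by rewrite mul_row_col mul0mx addr0 mulmxN mulNmx mxE.
Qed.

Lemma omul0r (x : 'cV[int]_d) : omul x 0 = 0. Proof. exact: mulmx0. Qed.
Lemma omul0l (x : 'cV[int]_d) : omul 0 x = 0. Proof. by rewrite omulC omul0r. Qed.

Lemma hmulE x1 y1 z1 x2 y2 z2 :
  (hmk x1 y1 z1 * hmk x2 y2 z2)%g = hmk (x1 + x2) (y1 + y2) (z1 + z2 - omul y1 x2).
Proof.
rewrite [LHS]/(gphi_mul _ _) /gphi_mul /=.
by rewrite formL_heis col_mxKd col_mxKu /hmk add_col_mx.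
Qed.

Lemma hone : 1%g = hmk 0 0 0.
Proof. by rewrite [LHS]/(gphi_one _) /gphi_one /hmk col_mx0. Qed.

Lemma hinvE x y z : (hmk x y z)^-1%g = hmk (- x) (- y) (- z - omul y x).
Proof.
apply: (mulgI (hmk x y z)); rewrite mulgV hone hmulE omulNr !subrr.
by rewrite opprK addrA subrr add0r addNr.
Qed.

Lemma hcommE x1 y1 z1 x2 y2 z2 :
  [~ hmk x1 y1 z1, hmk x2 y2 z2]%g = hmk 0 0 (omul x1 y2 - omul y1 x2).
Proof.
apply: (mulgI (hmk x2 y2 z2 * hmk x1 y1 z1)%g); rewrite -commgC !hmulE.
congr hmk; [by rewrite addr0 addrC|by rewrite addr0 addrC|].
by rewrite omul0r subr0 (omulC x1) [z1 + z2]addrC addrA subrK.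
Qed.

Lemma hxM g h : hx (g * h)%g = hx g + hx h.
Proof. by rewrite -(hmkE g) -(hmkE h) hmulE !hmk_proj. Qed.

Lemma hyM g h : hy (g * h)%g = hy g + hy h.
Proof. by rewrite -(hmkE g) -(hmkE h) hmulE !hmk_proj. Qed.

Lemma hzM g h : hz (g * h)%g = hz g + hz h - omul (hy g) (hx h).
Proof. by rewrite -{1}(hmkE g) -{1}(hmkE h) hmulE !hmk_proj. Qed.

Lemma hx1 : hx 1%g = 0. Proof. by rewrite hone hmk_proj. Qed.
Lemma hy1 : hy 1%g = 0. Proof. by rewrite hone hmk_proj. Qed.
Lemma hz1 : hz 1%g = 0. Proof. by rewrite hone. Qed.

Lemma hxV g : hx g^-1%g = - hx g.
Proof. by rewrite -{1}(hmkE g) hinvE !hmk_proj. Qed.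

Lemma hyV g : hy g^-1%g = - hy g.
Proof. by rewrite -{1}(hmkE g) hinvE !hmk_proj. Qed.

Lemma hxX g k : hx (g ^+ k)%g = hx g *+ k.
Proof. by elim: k => [|k IH]; rewrite ?expg0 ?hx1 // expgS hxM IH mulrS. Qed.

Lemma hyX g k : hy (g ^+ k)%g = hy g *+ k.
Proof. by elim: k => [|k IH]; rewrite ?expg0 ?hy1 // expgS hyM IH mulrS. Qed.

Lemma hmk0M z1 z2 : (hmk 0 0 z1 * hmk 0 0 z2)%g = hmk 0 0 (z1 + z2).
Proof. by rewrite hmulE omul0r !addr0 subr0. Qed.

Lemma hmk0V z : (hmk 0 0 z)^-1%g = hmk 0 0 (- z).
Proof. by rewrite hinvE omul0r subr0 oppr0. Qed.

Lemma hmk0X z k : (hmk 0 0 z ^+ k)%g = hmk 0 0 (z *+ k).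
Proof. by elim: k => [|k IH]; rewrite ?expg0 ?hone // expgS IH hmk0M mulrS. Qed.

Lemma mulmxn_eq0 n (x : 'cV[int]_n) k : (0 < k)%N -> x *+ k = 0 -> x = 0.
Proof.
move=> k0 /matrixP xk; apply/matrixP => i j; have := xk i j; rewrite mulmxnE !mxE.
by move/eqP; rewrite mulrn_eq0 -leqn0 leqNgt k0 => /eqP.
Qed.

Lemma heis_torsion_free : torsion_free H.
Proof.
move=> g k k0 gk.
have x0 : hx g = 0 by apply: (mulmxn_eq0 k0); rewrite -hxX gk hx1.
have y0 : hy g = 0 by apply: (mulmxn_eq0 k0); rewrite -hyX gk hy1.
move: gk; rewrite -(hmkE g) x0 y0 hmk0X hone => /(congr1 hz); rewrite !hmk_proj.
by move/(mulmxn_eq0 k0) ->.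
Qed.

(* A nonzero element of the order divides its norm, a nonzero integer. *)
Lemma heis_comm_norm x y : x != 0 \/ y != 0 -> exists2 N : int, N != 0 &
  forall c : 'cV[int]_d, exists x' y', omul x y' - omul y x' = N *: c.
Proof.
case=> [x0|y0].
  exists (\det (mul_mx_of x)) => [|c]; first exact: det_mul_mx_neq0.
  by exists 0, (\adj (mul_mx_of x) *m c); rewrite omul_adj omul0r subr0.
exists (\det (mul_mx_of y)) => [|c]; first exact: det_mul_mx_neq0.
exists (- (\adj (mul_mx_of y) *m c)), 0.
by rewrite omulNr omul_adj omul0r opprK add0r.
Qed.

Lemma scale_delta_neq0 (N : int) : N != 0 -> N *: delta_mx 0 0 != 0 :> 'cV[int]_d.
Proof.
move=> N0; apply/eqP => /matrixP/(_ 0 0); rewrite !mxE !eqxx mulr1.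
exact/eqP.
Qed.

(** The norm provides, for any element with x or y nonzero, a partner whose commutator with it is a
    nonzero integer in the order. *)
Lemma heis_centerP g : Defs.center H g <-> hx g = 0 /\ hy g = 0.
Proof.
split=> [cg|[x0 y0] h]; last first.
  apply/commgP/eqP; rewrite -(hmkE g) -(hmkE h) hcommE x0 y0 !omul0l subrr.
  by rewrite hone.
have [/andP[/eqP -> /eqP ->]//|/nandP xy] := boolP ((hx g == 0) && (hy g == 0)).
have [N N0 /(_ (delta_mx 0 0))[x' [y' E]]] := heis_comm_norm xy.
have /commgP/eqP := cg (hmk x' y' 0); rewrite -(hmkE g) hcommE E hone.
by move/(congr1 hz); rewrite !hmk_proj => /eqP; rewrite (negbTE (scale_delta_neq0 N0)).
Qed.

Lemma heis_skew : Defs.skew heis_mx.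
Proof.
by move=> i; rewrite tr_block_mx !trmx0 linearN /= struct_mx_sym opp_block_mx !oppr0 opprK.
Qed.

Lemma heis_full : Defs.full heis_mx.
Proof.
rewrite /Defs.full; have -> : form_span heis_mx = setT.
  apply/seteqP; split=> // v _ A [_ HA].
  (* Every v is the value of the form at (1, 0) and (0, v), so the span is everything and has a
     single coset. *)
  apply: HA; exists (col_mx (delta_mx 0 0) 0) => //; exists (col_mx 0 v) => //.
  by rewrite form_heis !col_mxKu !col_mxKd omul0r subr0 omul1l.
apply: (@sub_finite_set _ _ [set setT]); last exact: finite_set1.
move=> _ [v _ <-]; apply/seteqP; split=> // u _.
by exists (u - v) => //; rewrite addrC subrK.
Qed.

Lemma heis_lcs2 : lcs H 2 `<=` Defs.center H.
Proof.
apply: generated_min.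
  split=> [|g h /heis_centerP[gx gy] /heis_centerP[hx0 hy0]].
    exact/heis_centerP/(conj hx1 hy1).
  apply/heis_centerP; rewrite -(hmkE h) hinvE hxM hyM !hmk_proj gx gy hx0 hy0.
  by rewrite oppr0 addr0.
move=> _ [a _ [b _ <-]]; apply/heis_centerP.
by rewrite -(hmkE a) -(hmkE b) hcommE !hmk_proj.
Qed.

Lemma heis_lcs3 : lcs H 3 = [set 1%g].
Proof.
apply/seteqP; split; last by move=> _ ->; case: (generated_subgroup
  [set [~ a, b]%g | a in lcs H 2 & b in [set: H]]).
apply: generated_min; first by split=> // x y -> ->; rewrite mulgV.
move=> _ [a /heis_lcs2/heis_centerP[x0 y0] [b _ <-]].
by rewrite -(hmkE a) -(hmkE b) hcommE x0 y0 !omul0l subrr -hone.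
Qed.

Definition hbase : 'cV[int]_d := delta_mx 0 0.

Lemma hmk_comm z : hmk 0 0 z = [~ hmk hbase 0 0, hmk 0 z 0]%g.
Proof. by rewrite hcommE omul1l omul0r subr0. Qed.

Lemma hbase_neq0 : hbase != 0.
Proof. by rewrite -[hbase]scale1r scale_delta_neq0. Qed.

Lemma heis_nil_class : nil_class H = 2.
Proof.
apply: natmin_eq; first exact: heis_lcs3.
case=> [|[|//]] /= E.
  have : [set: H] (hmk 0 0 hbase) by [].
  rewrite -[[set: H]]/(lcs H 1) E hone => /(congr1 hz); rewrite !hmk_proj => /eqP.
  by rewrite (negbTE hbase_neq0).
have : lcs H 2 (hmk 0 0 hbase).
  by apply: sub_generated; rewrite hmk_comm; exists (hmk hbase 0 0) => //; exists (hmk 0 hbase 0).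
rewrite E hone => /(congr1 hz); rewrite !hmk_proj => /eqP.
by rewrite (negbTE hbase_neq0).
Qed.

Lemma heis_two_step : two_step_nilpotent H.
Proof. by split; [exists 2; exact: heis_lcs3|exact: heis_nil_class]. Qed.

Lemma int_col_closed n (P : set 'cV[int]_n) : P 0 -> (forall u v, P u -> P v -> P (u - v)) ->
  (forall i, P (delta_mx i 0)) -> forall v, P v.
Proof.
move=> P0 PB Pd v.
have PN u : P u -> P (- u) by move=> Pu; rewrite -sub0r; exact: PB.
have PD u w : P u -> P w -> P (u + w).
  by move=> Pu Pw; rewrite -[w]opprK; apply: PB => //; exact: PN.
have Pn k u : P u -> P (u *+ k) by move=> Pu; elim: k => // k IH; rewrite mulrS; exact: PD.
rewrite (matrix_sum_delta v); elim/big_ind: _ => // i _; rewrite big_ord1 -[v i 0]intz scaler_int.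
case: (v i 0) => k; first by rewrite -pmulrn; exact: Pn.
by rewrite NegzE mulrNz; apply: PN; rewrite -pmulrn; exact: Pn.
Qed.

Definition heis_gens : set H :=
  (fun i => hmk (delta_mx i 0) 0 0) @` [set: 'I_d] `|`
  (fun i => hmk 0 (delta_mx i 0) 0) @` [set: 'I_d].

Lemma heis_generates : generates heis_gens.
Proof.
apply/seteqP; split=> // g _.
have sG := generated_subgroup heis_gens.
have Gz z : generated heis_gens (hmk 0 0 z).
  move: z; apply: int_col_closed => [|u v Gu Gv|i]; first by rewrite -hone; case: sG.
    by rewrite -hmk0M -hmk0V; case: sG => _; apply.
  have Gb : generated heis_gens (hmk hbase 0 0) by apply: sub_generated; left; exists 0.
  have Gi : generated heis_gens (hmk 0 (delta_mx i 0) 0) by apply: sub_generated; right; exists i.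
  by rewrite hmk_comm commgEl conjgE;
     do !(apply: (is_subgroupM sG) || apply: (is_subgroupV sG)).
have Gx x : generated heis_gens (hmk x 0 0).
  move: x; apply: int_col_closed => [|u v Gu Gv|i]; first exact: Gz.
    have -> : hmk (u - v) 0 0 = (hmk u 0 0 / hmk v 0 0)%g.
      by rewrite hinvE hmulE !(oppr0, omul0l, omul0r, addr0).
    by case: sG => _; apply.
  by apply: sub_generated; left; exists i.
have Gy y : generated heis_gens (hmk 0 y 0).
  move: y; apply: int_col_closed => [|u v Gu Gv|i]; first exact: Gz.
    have -> : hmk 0 (u - v) 0 = (hmk 0 u 0 / hmk 0 v 0)%g.
      by rewrite hinvE hmulE !(oppr0, omul0l, omul0r, addr0).
    by case: sG => _; apply.
  by apply: sub_generated; right; exists i.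
have -> : g = (hmk (hx g) 0 0 * (hmk 0 (hy g) 0 * hmk 0 0 (hz g)))%g.
  by rewrite !hmulE !omul0r !subr0 !(addr0, add0r) omul0l subr0 hmkE.
by do !apply: (is_subgroupM sG).
Qed.

Lemma heis_fg : finitely_generated H.
Proof.
exists heis_gens; split; last exact: heis_generates.
by rewrite finite_setU; split; exact: finite_image.
Qed.

End Heisenberg.

(** * The commutator form over the complex numbers *)

Section Rank.
Variables (d' : nat) (R : realType).
Local Notation d := d'.+1.
Local Notation C := R[i].

Definition struct_comb (c : 'cV[C]_d) : 'M[C]_d :=
  \sum_(i < d) c i 0 *: map_mx intr (struct_mx i).

Lemma form_comb_heis (c : 'cV[C]_d) :
  form_comb (@heis_mx d') c = block_mx 0 (struct_comb c) (- struct_comb c) 0.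
Proof.
pose f (s : 'M[C]_d) : 'M[C]_(d + d) := block_mx 0 s (- s) 0.
rewrite -[RHS]/(f _) (big_morph f (id1 := 0) (op1 := +%R)); first last.
- by rewrite /f oppr0 block_mx0.
- by move=> u v; rewrite /f add_block_mx !addr0 opprD.
apply: eq_bigr => i _; rewrite /f map_block_mx !map_mx0 map_mxN scale_block_mx !scaler0.
by rewrite scalerN.
Qed.

(** Exchanging the two halves of the columns, by [P], leaves a block diagonal matrix with blocks A
    and -A. *)
Lemma rank_form_comb (c : 'cV[C]_d) :
  \rank (form_comb (@heis_mx d') c) = (\rank (struct_comb c)).*2.
Proof.
rewrite form_comb_heis; set A := struct_comb c.
pose P : 'M[C]_(d + d) := block_mx 0 1%:M 1%:M 0.
have PP : P *m P = 1%:M.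
  by rewrite mulmx_block !(mul0mx, mulmx0, mul1mx, addr0, add0r) -scalar_mx_block.
have Pf : row_free P by rewrite row_free_unit; case/mulmx1_unit: PP.
rewrite -(mxrankMfree _ Pf) mulmx_block !(mul0mx, mulmx0, mulmx1, addr0, add0r).
by rewrite rank_diag_block_mx mxrank_opp addnn.
Qed.

Lemma struct_comb_delta i : struct_comb (delta_mx i 0) = map_mx intr (struct_mx i).
Proof.
rewrite /struct_comb (bigD1 i) //= big1 ?addr0 ?mxE ?eqxx ?scale1r //.
by move=> j /negbTE ji; rewrite mxE ji scale0r.
Qed.

Lemma struct_comb_linear : linear struct_comb.
Proof.
move=> a u v; rewrite /struct_comb scaler_sumr -big_split; apply: eq_bigr => i _.
by rewrite !mxE scalerDl scalerA.
Qed.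

(* Evaluation at a root of X^d - 3 is multiplicative, so its form has rank one. *)
Lemma rank_struct_root (r : C) : r ^+ d = 3 ->
  (\rank (struct_comb (\col_i r ^+ i)) <= 1)%N.
Proof.
move=> rd; have -> : struct_comb (\col_i r ^+ i) =
    (\col_(a < d) r ^+ a) *m (\row_(b < d) r ^+ b).
  apply/matrixP => a b; rewrite !mxE big_ord1 !mxE -exprD -(oeval_struct rd) summxE.
  by apply: eq_bigr => i _; rewrite !mxE mulrC.
by rewrite (leq_trans (mulmx_max_rank _ _)).
Qed.

Lemma d_form_heis : d_form (@heis_mx d') R = 2.
Proof.
apply: natmin_eq; last first.
  (* The ranks are even, so a maximum below 2 would kill the combinations along a basis, hence all
     of them; but the matrix for i = 0 has entry 1 at (0, 0). *)
  move=> _ [a [ba ->]]; rewrite leEnat leqNgt; apply/negP => lt2.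
  have z j : struct_comb (tnth a j) = 0.
    apply/eqP; rewrite -mxrank_eq0 -leqn0 -ltnS -(ltn_double _ 1) -rank_form_comb.
    apply: leq_ltn_trans lt2.
    exact: (leq_bigmax_cond (F := fun j => \rank (form_comb _ (tnth a j)))).
  have : struct_comb (delta_mx 0 0) = 0.
    have /coord_span -> : delta_mx 0 0 \in <<a>>%VS by rewrite (span_basis ba) memvf.
    rewrite (big_morph struct_comb (id1 := 0) (op1 := +%R)); first last.
    - by rewrite /struct_comb big1 // => i _; rewrite mxE scale0r.
    - by move=> u v; rewrite -[u]scale1r struct_comb_linear !scale1r.
    apply: big1 => j _; rewrite -[X in struct_comb X]addr0 struct_comb_linear.
    by rewrite -tnth_nth z scaler0 add0r /struct_comb big1 // => i _; rewrite mxE scale0r.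
  rewrite struct_comb_delta => /matrixP/(_ 0 0)/eqP; rewrite !mxE /=.
  by rewrite intr_eq0.
have [r [rI rd]] := @roots3 d' C.
(* The j-th vector holds the values of the powers of X at the root r j, so it is the evaluation at
   that root; Vandermonde's determinant makes the family free. *)
pose a : d.-tuple 'cV[C]_d := [tuple \col_i r j ^+ i | j < d].
have aj j : tnth a j = \col_i r j ^+ i by rewrite tnth_mktuple.
have fa : free a.
  apply/freeP => k ka.
  have : (\row_j k j) *m \matrix_(i < d, j < d) r i ^+ j = 0.
    apply/rowP => i; rewrite [LHS]mxE [RHS]mxE.
    transitivity ((\sum_(j < d) k j *: a`_j) i 0); last by rewrite ka mxE.
    by rewrite summxE; apply: eq_bigr => j _; rewrite -tnth_nth aj !mxE.
  move/(congr1 (mulmx^~ (invmx (\matrix_(i < d, j < d) r i ^+ j)))).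
  rewrite mulmxK ?unit_Vandermonde // mul0mx => /rowP k0 i.
  by have := k0 i; rewrite !mxE.
exists a; split.
  by rewrite basisEfree fa subvf dimvf size_tuple /dim /= muln1 leqnn.
have le j : (\rank (struct_comb (tnth a j)) <= 1)%N by rewrite aj rank_struct_root.
apply/esym/eqP; rewrite eqn_leq; apply/andP; split.
  by apply/bigmax_leqP => j _; rewrite rank_form_comb (leq_double _ 1).
apply: leq_trans (leq_bigmax (F := fun j => \rank (form_comb (@heis_mx d') (tnth a j))) 0).
rewrite rank_form_comb (leq_double 1) lt0n mxrank_eq0; apply/eqP => /matrixP/(_ 0 0)/eqP.
rewrite aj summxE (eq_bigr (fun i : 'I_d => (struct_mx i 0 0)%:~R * (r 0) ^+ i)); last first.
  by move=> i _; rewrite !mxE mulrC.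
by rewrite (oeval_struct (rd 0)) /= expr0 mxE oner_eq0.
Qed.

Lemma k_const_heis : k_const R (Gphi (@heis_mx d')) 1.
Proof.
exists (d + d)%N, d, (@heis_mx d'); split; [exact: heis_skew|exact: heis_full| |exact: d_form_heis].
by exists idfun; exists id.
Qed.
End Rank.

(** * Residual finiteness growth *)

Section Growth.
Variable d' : nat.
Local Notation d := d'.+1.
Local Notation H := (Gphi (@heis_mx d')).
Local Notation base := (@hbase d').

Definition coord_le (b : nat) (v : 'cV[int]_d) := forall i, (absz (v i 0%R) <= b)%N.

Lemma coord_leD b c u v : coord_le b u -> coord_le c v -> coord_le (b + c) (u + v).
Proof. by move=> ub vc i; rewrite mxE; move: (u i 0) (v i 0) (ub i) (vc i) => x y; lia. Qed.

Lemma coord_leN b u : coord_le b u -> coord_le b (- u).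
Proof. by move=> ub i; rewrite mxE abszN; exact: ub. Qed.

Lemma coord_leW b c u : (b <= c)%N -> coord_le b u -> coord_le c u.
Proof. by move=> bc ub i; exact: leq_trans (ub i) bc. Qed.

Lemma absz_sum (I : Type) (s : seq I) (F : I -> int) :
  (absz (\sum_(i <- s) F i)%R <= \sum_(i <- s) absz (F i))%N.
Proof.
elim: s => [|i s IH]; first by rewrite !big_nil.
rewrite !big_cons; set x := \sum_(j <- s) F j in IH *.
by apply: leq_trans (leq_add (leqnn _) IH); move: x {IH} (F i) => x y; lia.
Qed.

Lemma coord_le_omul b c u v : coord_le b u -> coord_le c v ->
  coord_le (4 * d ^ 2 * b * c) (omul u v).
Proof.
move=> ub vc i; rewrite mxE (leq_trans (absz_sum _ _)) //.
apply: (@leq_trans (\sum_(a < d) 4 * d * b * c)%N); last first.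
  by rewrite sum_nat_const card_ord; nia.
apply: leq_sum => a _; rewrite abszM; apply: leq_mul => //.
rewrite mxE (leq_trans (absz_sum _ _)) //.
apply: (@leq_trans (\sum_(e < d) 4 * b)%N); last by rewrite sum_nat_const card_ord; nia.
apply: leq_sum => e _; rewrite abszM mulnC; apply: leq_mul => //.
by rewrite mxE; case: (_ == _); case: (_ == _).
Qed.

(** In the word length, x and y grow linearly and z quadratically, because of the term y x'. Only
    logarithms are taken later, so one quadratic bound serves all three. *)
Lemma coord_growth (S : set H) : finite_set S -> exists K, (0 < K)%N /\
  forall w, is_word S w -> let g := (\prod_(x <- w) x)%g in
    [/\ coord_le (K * (size w) ^ 2) (hx g), coord_le (K * (size w) ^ 2) (hy g)
      & coord_le (K * (size w) ^ 2) (hz g)].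
Proof.
move=> /finite_seqP[s ->].
pose nm (g : H) := (\sum_i (absz (hx g i 0%R) + absz (hy g i 0%R) + absz (hz g i 0%R)))%N.
pose M := (\sum_(g <- s) (nm g + nm g^-1%g)).+1%N.
have nmM g : g \in s -> (nm g <= M /\ nm g^-1%g <= M)%N.
  by move=> gs; rewrite /M (big_rem g) //=; lia.
have nmc g : [/\ coord_le (nm g) (hx g), coord_le (nm g) (hy g) & coord_le (nm g) (hz g)].
  by split=> i; rewrite /nm (bigD1 i) //=; lia.
have letter x : is_word [set` s] [:: x] ->
    [/\ coord_le M (hx x), coord_le M (hy x) & coord_le M (hz x)].
  move=> /(_ x (mem_head _ _)) xs; have xM : (nm x <= M)%N.
    by case: xs => /nmM[]; rewrite ?invgK.
  by have [? ? ?] := nmc x; split; apply: coord_leW xM _.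
(* One more letter in a word of length l adds at most M + 4 d^2 M^2 l to z, and K (l + 1)^2 - K l^2
   = K (2l + 1) covers this. *)
pose K := (M + 4 * d ^ 2 * M * M)%N.
exists K; split=> [|w sw /=]; first by rewrite /K /M.
suff: [/\ coord_le (M * size w) (hx (\prod_(x <- w) x)%g),
          coord_le (M * size w) (hy (\prod_(x <- w) x)%g)
        & coord_le (K * (size w) ^ 2) (hz (\prod_(x <- w) x)%g)].
  move=> [xb yb zb]; split=> //; [apply: coord_leW xb|apply: coord_leW yb];
    by apply: leq_mul; [exact: leq_addr|case: (size w) => // l; rewrite -mulnn leq_pmulr].
elim: w sw => [|x w IH] sw.
  by rewrite big_nil hx1 hy1 hz1; split=> i; rewrite mxE.
have /IH[xb yb zb] : is_word [set` s] w by move=> y yw; apply: sw; rewrite inE yw orbT.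
have /letter[xb1 yb1 zb1] : is_word [set` s] [:: x].
  by move=> y; rewrite inE => /eqP ->; apply: sw; rewrite mem_head.
rewrite big_cons hxM hyM hzM /=; split.
- by apply: coord_leW (coord_leD xb1 xb); rewrite mulnS.
- by apply: coord_leW (coord_leD yb1 yb); rewrite mulnS.
apply: coord_leW (coord_leD (coord_leD zb1 zb) (coord_leN (coord_le_omul yb1 xb))).
rewrite /K mulnA; move: (4 * d ^ 2 * M * M)%N (size w) => E l; rewrite -!mulnn; nia.
Qed.

Definition detectable (g : H) (k : nat) := exists N : set H,
  [/\ normal_in N [set: H], ~ N g & has_index [set: H] N k].

Variable R : realType.

Definition norm_bound b := (d`! * (4 * d * b) ^ d)%N.

Lemma absz_det_le (v : 'cV[int]_d) b : coord_le b v ->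
  (absz (\det (mul_mx_of v)) <= norm_bound b)%N.
Proof.
move=> vb; rewrite -lez_nat abszE /norm_bound.
apply: le_trans (@norm_det_le _ v b%:Z _) _ => [a|]; first by rewrite -abszE lez_nat.
by rewrite -[leRHS]natz natrM natrX !natrM [b%:R]natz.
Qed.

Lemma detect_bounded k (g : H) b X : d = (3 ^ k)%N -> g <> 1%g ->
  coord_le b (hx g) -> coord_le b (hy g) -> coord_le b (hz g) -> (0 < X)%N ->
  ln ((norm_bound b)%:R : R) < X%:R / 128 - 200 ->
  exists2 n, (n <= X ^ 3)%N & detectable g n.
Proof.
move=> dk g1 xb yb zb X0 lnX.
(* Any nonzero coordinate will do, central or not: the reduction modulo q evaluates the three
   coordinates separately. *)
have [v [v0 vb vg]] : exists v, [/\ v != 0, coord_le b v & [\/ v = hx g, v = hy g | v = hz g]].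
  have [x0|] := eqVneq (hx g) 0; last by exists (hx g); split=> //; constructor 1.
  have [y0|] := eqVneq (hy g) 0; last by exists (hy g); split=> //; constructor 2.
  have [z0|] := eqVneq (hz g) 0; last by exists (hz g); split=> //; constructor 3.
  by exfalso; apply: g1; rewrite -(hmkE g) x0 y0 z0 hone.
set D := absz (\det (mul_mx_of v)).
have D0 : (0 < D)%N by rewrite absz_gt0 det_mul_mx_neq0.
have [p [j [pp q2 qX qD]]] : exists p j, [/\ prime p, (p ^ j %% 3 = 2)%N,
    (p ^ j <= X)%N & ~~ (p ^ j %| D)%N].
  apply: contrapT => no; have : X%:R / 128 - 200 <= ln (D%:R : R).
    apply: chebyshev_mod3 => // p j pp j0 qX q2; apply: contrapT => /negP qD.
    by apply: no; exists p, j.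
  apply/negP; rewrite -ltNge (le_lt_trans _ lnX) // ler_ln ?posrE ?ltr0n //.
    by rewrite ler_nat absz_det_le.
  by rewrite (leq_trans D0) // absz_det_le.
have [t td] := root3_mod k pp q2; rewrite -dk in td.
set q := (p ^ j)%N in q2 qX qD t td.
have q1 : (1 < q)%N by case: (q) q2 => [|[|]].
have tv : oeval t v != 0 by apply: contra qD => /eqP; exact: dvdn_det.
pose F (h : H) := (oeval t (hx h), oeval t (hy h), oeval t (hz h)).
pose op (a b : 'Z_q * 'Z_q * 'Z_q) :=
  (a.1.1 + b.1.1, a.1.2 + b.1.2, a.2 + b.2 - a.1.2 * b.1.1).
have Fop h h' : F (h * h')%g = op (F h) (F h').
  by rewrite /F /op hxM hyM hzM !oevalD oevalN oevalM.
have [nN [n nle ni]] := kernel_index Fop.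
have cT : #|{: 'Z_q * 'Z_q * 'Z_q}| = (q ^ 3)%N.
  by rewrite !card_prod card_ord Zp_cast // mulnn -expnSr.
exists n.
  by rewrite (leq_trans nle) // -[X in (X <= _)%N]/#|{: 'Z_q * 'Z_q * 'Z_q}| cT leq_exp2r.
exists [set h | F h = F 1%g]; split=> //= -[].
have o0 : oeval t (0 : 'cV[int]_d) = 0.
  by rewrite -[X in oeval _ X](subrr v) oevalD oevalN subrr.
rewrite hx1 hy1 hz1 o0 => Fx Fy Fz; move/eqP: tv.
by case: vg => ->.
Qed.

Variable k : nat.
Hypothesis dk : d = (3 ^ k)%N.

Lemma detect (g : H) : g <> 1%g -> exists n, detectable g n.
Proof.
move=> g1.
(* With g as the only letter and a word of length 1, this merely bounds the coordinates of g. *)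
have [K [K0 Kb]] := coord_growth (finite_set1 g).
have [|xb yb zb] := Kb [:: g]; first by move=> y; rewrite inE => /eqP ->; left.
rewrite big_seq1 in xb yb zb.
pose X := (Num.truncn (128 * (ln ((norm_bound (K * 1 ^ 2))%:R : R) + 200))).+1.
have [] := @detect_bounded k g _ X dk g1 xb yb zb; rewrite /X //.
  have := truncnS_gt (128 * (ln ((norm_bound (K * 1 ^ 2))%:R : R) + 200)); lra.
by move=> n _; exists n.
Qed.

Section WithGens.
Variable S : set H.
Hypotheses (finS : finite_set S) (genS : generates S).

Lemma Ddiv_upper : exists A B : R, [/\ 0 <= A, 0 <= B & forall (r : R) (g : H),
  1 <= r -> g <> 1%g -> ball_word S r g -> (Ddiv g)%:R <= (A + B * ln r) ^+ 3].
Proof.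
have [K [K0 Kb]] := coord_growth finS.
pose a := ln ((norm_bound K)%:R : R).
have a0 : 0 <= a by exact: ln_natr_ge0.
(* These solve X/128 - 200 > a + 2 d ln r: for y below, the cut-off X is the integer part of y plus
   1, at most y + 1 = A + B ln r. *)
exists (128 * (a + 200) + 1), (256 * d%:R); split; [lra|by rewrite mulr_ge0|].
move=> r g r1 g1 gr; have r0 : 0 < r by lra.
have [w [Sw wg ws]] := word_normP genS g.
have [] := Kb w Sw; rewrite wg => xb yb zb.
have lr : (size w)%:R <= r by rewrite ws.
have w0 : (0 < size w)%N.
  by rewrite lt0n; apply/eqP => /size0nil w0; apply: g1; rewrite -wg w0 big_nil.
have nb : ln ((norm_bound (K * size w ^ 2))%:R : R) <= a + 2 * d%:R * ln r.
  (* The norm has degree d in coordinates that are quadratic in the length, whence the exponent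
     2d. *)
  have -> : norm_bound (K * size w ^ 2) = (norm_bound K * (size w) ^ (2 * d))%N.
    by rewrite /norm_bound expnM mulnA expnMn mulnA.
  rewrite natrM lnM ?posrE ?ltr0n ?expn_gt0 ?w0 ?muln_gt0 ?fact_gt0 ?expn_gt0 ?muln_gt0 ?K0 //.
  rewrite lerD2l natrX lnXn ?ltr0n // -[leLHS]mulr_natl natrM ler_wpM2l ?mulr_ge0 //.
  by rewrite ler_ln ?posrE ?ltr0n.
have lnr0 : 0 <= ln r by rewrite ln_ge0.
have dl0 : 0 <= d%:R * ln r by rewrite mulr_ge0.
pose y := 128 * (a + 2 * d%:R * ln r + 200).
have y0 : 0 <= y by rewrite /y; lra.
have [] := @detect_bounded k g _ (Num.truncn y).+1 dk g1 xb yb zb => //.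
  by have := truncnS_gt y; rewrite /y; lra.
move=> n nX gn; apply: (@le_trans _ _ (((Num.truncn y).+1 ^ 3)%N%:R)).
  by rewrite ler_nat (leq_trans _ nX) //; apply: natmin_le.
rewrite natrX lerXn2r ?nnegrE //; first by move: dl0 a0; lra.
by rewrite -natr1; have := truncn_le y; rewrite /y; lra.
Qed.

(** The values on the ball are bounded by [Ddiv_upper], so that [natmax] is a true maximum and not
    its default 0. *)
Lemma RF_ge (g : H) (r : R) : 1 <= r -> g <> 1%g -> ball_word S r g ->
  (Ddiv g <= RF S r)%N.
Proof.
move=> r1 g1 gr; have [A [B [_ _ AB]]] := Ddiv_upper.
apply: (@natmax_ge _ _ (Num.truncn ((A + B * ln r) ^+ 3))); last by exists g.
move=> _ [h [h1 hr] <-]; have hle := AB _ _ r1 h1 hr.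
by rewrite truncn_ge_nat ?(le_trans _ hle).
Qed.

Lemma RF_upper : growth_le (fun r : R => (RF S r)%:R) (fun r : R => ln r ^+ 3).
Proof.
have [A [B [A0 B0 AB]]] := Ddiv_upper.
pose m := A + B; have m0 : 0 <= m by rewrite addr_ge0.
have e1 : 1 <= expR 1 :> R by rewrite -expR0 ler_expR.
(* As C >= e, ln (C r) >= 1 + ln r, so A + B ln r <= m ln (C r); the summand m^3 absorbs the cube of
   m. *)
pose C := m ^+ 3 + expR 1; have C1 : expR 1 <= C by rewrite lerDr exprn_ge0.
have C0 : 0 < C by lra.
exists C => // r; rewrite ge_max => /andP[r1 _].
have lnr0 : 0 <= ln r by rewrite ln_ge0.
have lnC : 1 <= ln C by rewrite -(expRK 1) ler_ln ?posrE ?expR_gt0.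
apply: (@le_trans _ _ ((A + B * ln r) ^+ 3)).
  rewrite /RF; set Q := [set Ddiv g | g in _].
  have [[n Qn]|Q0] := pselect (exists n, Q n); last first.
    rewrite /natmax xgetPN => [|n [Qn _]]; last by apply: Q0; exists n.
    by rewrite exprn_ge0 // addr_ge0 // mulr_ge0.
  have ub i : Q i -> (i <= Num.truncn ((A + B * ln r) ^+ 3))%N.
    by move=> [h [h1 hr] <-]; have hle := AB _ _ r1 h1 hr; rewrite truncn_ge_nat ?(le_trans _ hle).
  have [[h [h1 hr] <-] _] := natmax_spec Qn ub.
  exact: AB.
have lnCr : ln (C * r) = ln C + ln r by rewrite lnM ?posrE //; lra.
apply: (@le_trans _ _ ((m * ln (C * r)) ^+ 3)).
  rewrite lerXn2r ?nnegrE ?addr_ge0 ?mulr_ge0 // lnCr /m; [lra|nra].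
rewrite exprMn; apply: ler_wpM2r; last by rewrite lerDl expR_ge0.
by rewrite exprn_ge0 // lnCr; lra.
Qed.

Lemma central_scale (N : set H) (c : int) v : is_subgroup N ->
  N (hmk 0 0 v) -> N (hmk 0 0 (c *: v)).
Proof.
move=> sN Nv; rewrite -[c]intz scaler_int.
case: c => n; first by rewrite -pmulrn -hmk0X; apply: is_subgroupX.
rewrite NegzE mulrNz -pmulrn -hmk0V -hmk0X.
by apply: is_subgroupV => //; apply: is_subgroupX.
Qed.

Lemma Ddiv_lower (L n : nat) : (forall i, (0 < i <= n)%N -> (i %| L)%N) -> (0 < L)%N ->
  (n.+1 ^ 3 <= Ddiv (hmk 0 0 ((L * L)%N%:Z *: base)))%N.
Proof.
move=> Ln L0; set g := hmk _ _ _.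
have g1 : g <> 1%g.
  rewrite hone => /(congr1 (@hz _)); rewrite !hmk_proj => /eqP; apply/negP.
  by rewrite scale_delta_neq0 //; lia.
have [m0 gm0] := detect g1.
have [N [nN Ng Ni]] := natmin_in (A := detectable g) gm0.
have [sN _ _ _] := nN.
(* A nonzero a of absolute value at most n divides L, hence L^2; if N contained a in the center, it
   would contain g. *)
have small (a : int) : (absz a <= n)%N -> N (hmk 0 0 (a *: base)) -> a = 0.
  move=> an Na; apply: contrapT => /eqP a0; apply: Ng.
  have /dvdzP[c E] : (a %| (L * L)%N%:Z)%Z.
    by rewrite dvdzE absz_nat dvdn_mulr // Ln // absz_gt0 a0.
  by rewrite /g E -scalerA; exact: central_scale.
pose f (s : 'I_n.+1 * 'I_n.+1 * 'I_n.+1) : H :=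
  hmk (s.1.1%:Z *: base) (s.1.2%:Z *: base) (s.2%:Z *: base).
have := @leq_index H setT N _ f _ sN Ni (fun=> I).
rewrite !card_prod !card_ord mulnn -expnSr; apply.
move=> [[i j] e] [[i' j'] e']; rewrite /f /= => Nu; set u := (_ * _)%g in Nu.
have ux : hx u = (i'%:Z - i%:Z) *: base.
  by rewrite hxM hinvE !hmk_proj addrC -scalerBl.
have uy : hy u = (j'%:Z - j%:Z) *: base.
  by rewrite hyM hinvE !hmk_proj addrC -scalerBl.
have di (a b : 'I_n.+1) : (absz (a%:Z - b%:Z) <= n)%N.
  by have := ltn_ord a; have := ltn_ord b; lia.
(* Commutation with (0, 1, 0) turns the difference of the x-coordinates into a central element of N,
   to which [small] applies; (1, 0, 0) does the same for y. *)
have ii : i'%:Z - i%:Z = 0.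
  apply: small => //; have := comm_in (hmk 0 base 0) nN Nu.
  by rewrite -(hmkE u) hcommE ux omul0r subr0 omulZl omul1l.
have jj : j'%:Z - j%:Z = 0.
  apply/eqP; rewrite -oppr_eq0; apply/eqP; apply: small; first by rewrite abszN.
  have := comm_in (hmk base 0 0) nN Nu.
  by rewrite -(hmkE u) hcommE uy omul0r sub0r omulZl omul1l scaleNr.
have /val_inj ei : i = i' :> nat by lia.
have /val_inj ej : j = j' :> nat by lia.
have ee : e'%:Z - e%:Z = 0.
  apply: small => //; move: Nu; rewrite /u ei ej hinvE hmulE.
  rewrite !addNr omulNl opprK [_ - omul _ _ + _]addrAC subrK addrC -scalerBl.
  by [].
have /val_inj -> : e = e' :> nat by lia.
by rewrite ei ej.
Qed.

Lemma RF_lower : growth_le (fun r : R => ln r ^+ 3) (fun r : R => (RF S r)%:R).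
Proof.
set X := hmk base 0 0; set Y := hmk 0 base 0.
pose W := (2 * (word_norm S X + word_norm S Y))%N.
(* The constant 216 = 6^3 comes from ln r < 6 n. The other summand bounds the word: ln L <= 6 n <=
   ln r + 6 gives L <= e^6 r, and the commutator has length at most L W. *)
pose C : R := 216 + expR 6 * W%:R.
have C216 : 216 <= C by rewrite lerDl mulr_ge0 // expR_ge0.
have C0 : 0 < C by lra.
exists C => // r; rewrite ge_max => /andP[r1 _].
have r0 : 0 < r by lra.
have lnr0 : 0 <= ln r by rewrite ln_ge0.
pose n := (Num.truncn (ln r / 6)).+1.
have n_gt : ln r / 6 < n%:R by exact: truncnS_gt.
have n_le : 6 * n%:R <= ln r + 6.
  have l6 : 0 <= ln r / 6 by lra.
  have nE : n%:R = (Num.truncn (ln r / 6))%:R + 1 :> R by rewrite natr1.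
  by have /andP[+ _] := truncn_itv l6; rewrite nE; lra.
have [L [L0 Ln lnL]] := small_common_multiple R (ltn0Sn _ : 0 < n)%N.
have Lr : L%:R <= expR 6 * r :> R.
  rewrite -ler_ln ?posrE ?ltr0n ?mulr_gt0 ?expR_gt0 // lnM ?posrE ?expR_gt0 // expRK; lra.
have gE : hmk 0 0 ((L * L)%N%:Z *: base) = [~ X ^+ L, Y ^+ L]%g.
  have bL : base *+ L = L%:Z *: base by rewrite -scaler_nat natz.
  rewrite -(hmkE (X ^+ L)%g) -(hmkE (Y ^+ L)%g) hcommE !hxX !hyX !hmk_proj !mul0rn.
  by rewrite omul0l subr0 bL omulZl omul1l scalerA PoszM.
have Dg := Ddiv_lower Ln L0; rewrite gE in Dg.
have gr : ball_word S (C * r) [~ X ^+ L, Y ^+ L]%g.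
  rewrite /ball_word /=; apply: (@le_trans _ _ ((L * W)%N%:R)).
    rewrite ler_nat (leq_trans (word_normR genS _ _)) // /W mulnCA leq_mul2l /= mulnDr.
    by rewrite leq_add // word_normX.
  rewrite natrM; apply: (@le_trans _ _ (expR 6 * r * W%:R)); first by rewrite ler_wpM2r.
  by rewrite /C mulrDl mulrAC lerDr; lra.
have g1 : [~ X ^+ L, Y ^+ L]%g <> 1%g.
  rewrite -gE hone => /(congr1 (@hz _)); rewrite !hmk_proj => /eqP; apply/negP.
  by rewrite scale_delta_neq0 //; lia.
have Cr1 : 1 <= C * r by nra.
have /(leq_trans Dg) RFn := RF_ge Cr1 g1 gr.
have RFR : (n.+1 ^ 3)%N%:R <= (RF S (C * r))%:R :> R by rewrite ler_nat.
apply: (@le_trans _ _ (216 * (RF S (C * r))%:R)); last by rewrite ler_wpM2r.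
apply: le_trans (ler_wpM2l _ RFR); last by [].
rewrite natrX (_ : 216 * _ = (6 * n.+1%:R) ^+ 3); last by ring.
rewrite lerXn2r ?nnegrE //; have : n%:R <= n.+1%:R :> R by rewrite ler_nat.
by lra.
Qed.

End WithGens.

Lemma RF_class_heis : RF_class H (fun r : R => ln r ^+ 3).
Proof. by move=> S finS genS; split; [exact: RF_upper|exact: RF_lower]. Qed.

End Growth.

(** * Hirsch length *)

Section HirschRank.
Local Open Scope group_scope.
Variables (Q : groupType) (m : nat) (w : Q -> 'rV[int]_m).
Hypothesis wM : forall x y, w (x * y) = (w x + w y)%R.
Hypothesis w_central : forall x, w x = 0%R -> forall y, x * y = y * x.
Hypothesis w_rank1 : forall c c', w c = 0%R -> w c' = 0%R -> c <> 1 ->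
  exists2 j, (0 < j)%N & generated [set c] (c' ^+ j).
Hypothesis tfQ : torsion_free Q.

Let W g : 'rV[rat]_m := map_mx intr (w g).

Lemma w1 : w 1 = 0%R.
Proof. by have := wM 1 1; rewrite mulg1 => /eqP; rewrite addrC -subr_eq subrr => /eqP. Qed.

Lemma wV x : w x^-1 = (- w x)%R.
Proof. by apply/eqP; rewrite -addr_eq0 -wM mulVg w1. Qed.

Lemma wX x n : w (x ^+ n) = (w x *+ n)%R.
Proof. by elim: n => [|n IH]; rewrite ?expg0 ?w1 // expgS wM IH mulrS. Qed.

Lemma WM x y : W (x * y) = (W x + W y)%R.
Proof. by rewrite /W wM map_mxD. Qed.

Lemma WV x : W x^-1 = (- W x)%R.
Proof. by rewrite /W wV map_mxN. Qed.

Lemma WX x n : W (x ^+ n) = (W x *+ n)%R.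
Proof. by rewrite /W wX raddfMn. Qed.

Lemma W_eq0 x : W x = 0%R -> w x = 0%R.
Proof.
move=> /matrixP Wx; apply/matrixP => i j; have := Wx i j; rewrite !mxE => /eqP.
by rewrite intr_eq0 => /eqP.
Qed.

Definition has_kernel (K : set Q) := `[< exists c, [/\ K c, c <> 1 & w c = 0%R] >].

(** The rank of the image of K in Q^m plus that of its intersection with the kernel of [w], which is
    0 or 1 by [w_rank1]. It is an invariant of K, whatever series leads to K, as needed because
    [hirsch] selects an arbitrary series. *)
Definition rank_is (K : set Q) (h : nat) :=
  exists (r : nat) (B : 'M[rat]_(r, m)),
    [/\ row_free B, forall i, exists2 g, K g & row i B = W g,
        forall g, K g -> (W g <= B)%MS & h = (r + has_kernel K)%N].

(** Normality of K lets all its factors be collected on the left; an integer power of x is written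
    as a quotient of two natural powers. *)
Lemma generated_cyclic_ext (K H : set Q) x : normal_in K H ->
  H = generated (K `|` [set x]) ->
  forall h, H h -> exists (k : Q) (i j : nat), K k /\ h = k * (x ^+ i / x ^+ j).
Proof.
move=> [sK sH KH nKH] HE h; rewrite HE.
have Hx : H x by rewrite HE; apply: sub_generated; right.
pose T := [set h | exists (k : Q) (i j : nat), K k /\ h = k * (x ^+ i / x ^+ j)].
apply: (@generated_min _ _ T); last first.
  move=> y [Ky|->]; first by exists y, 0, 0; rewrite !expg0 mulgV mulg1.
  by exists 1, 1%N, 0; rewrite expg0 invg1 mulg1 mul1g expg1; case: sK.
have XC a b : commute (x ^+ a) (x ^+ b)^-1 by apply: commuteV; apply: commuteX2.
split=> [|_ _ [k [i [j [Kk ->]]]] [k' [i' [j' [Kk' ->]]]]].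
  by exists 1, 0, 0; rewrite !expg0 mulgV mulg1; case: sK.
set u := x ^+ (i + j') / x ^+ (j + i').
have uE : (x ^+ i / x ^+ j) * (x ^+ j' / x ^+ i') = u.
  rewrite /u !expgnDr invgM -!mulgA; congr (_ * _).
  by rewrite [LHS]mulgA -XC -!mulgA; congr (_ * _); rewrite -!invgM -!expgnDr addnC.
have Hu : H u.
  by apply: (is_subgroupM sH); [|apply: is_subgroupV => //]; exact: is_subgroupX.
exists (k * (k'^-1 ^ u^-1)), (i + j')%N, (j + i')%N; split.
  apply: (is_subgroupM sK) => //; apply: nKH; first exact: is_subgroupV.
  exact: is_subgroupV.
rewrite -/u invgM (invgF (x ^+ i') _) conjgE invgK; clearbody u.
by rewrite -!mulgA mulVg mulg1 -uE -!mulgA.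
Qed.

(** Clearing the denominators of the coefficients over the rows of B turns rational dependence into
    an equality for some positive power of x. *)
Lemma rational_span (K : set Q) r (B : 'M[rat]_(r, m)) x : is_subgroup K ->
  (forall i, exists2 g, K g & row i B = W g) -> (W x <= B)%MS ->
  exists2 n, (0 < n)%N & exists2 k, K k & w (x ^+ n) = w k.
Proof.
move=> sK BK.
pose P (y : 'rV[rat]_m) := exists2 n, (0 < n)%N & exists2 k, K k & (y *+ n)%R = W k.
suff PB y : (y <= B)%MS -> P y.
  move=> /PB[n n0 [k Kk xk]]; exists n => //; exists k => //.
  by apply/eqP; rewrite -subr_eq0 -wV -wM; apply/eqP/W_eq0; rewrite WM WV WX xk subrr.
case/submxP => v ->; rewrite mulmx_sum_row; elim/big_ind: _ => [|y1 y2|i _].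
- by exists 1%N => //; exists 1; [case: sK|rewrite /W w1 map_mx0].
- move=> [n n0 [k Kk yk]] [n' n0' [k' Kk' yk']]; exists (n * n')%N; first by rewrite muln_gt0 n0.
  exists (k ^+ n' * k' ^+ n); first by apply: (is_subgroupM sK); exact: is_subgroupX.
  by rewrite WM !WX -yk -yk' mulrnDl mulrnA mulnC mulrnA.
have [g Kg ->] := BK i; set q := v _ _.
have PZ (c : int) : exists2 k, K k & W k = (c%:~R *: W g)%R.
  case: c => n; first by exists (g ^+ n); [exact: is_subgroupX|rewrite WX scaler_int -pmulrn].
  exists (g ^+ n.+1)^-1; first by apply: is_subgroupV => //; exact: is_subgroupX.
  by rewrite WV WX NegzE scaler_int mulrNz -pmulrn.
have [k Kk kE] := PZ (numq q); exists (absz (denq q)); first by rewrite absz_gt0 denq_eq0.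
exists k => //; rewrite kE -scaler_nat scalerA; congr (_ *: _)%R.
rewrite -{2}(divq_num_den q) mulrCA.
by rewrite (_ : (absz (denq q))%:R = (denq q)%:~R)%R ?mulfV ?mulr1 ?intr_eq0 ?denq_eq0 //
  -[in RHS](absz_denq q) pmulrn.
Qed.

(** A finite step changes neither summand. An infinite step raises exactly one of them: the kernel
    part if W x already lies in the span, the rank of the image otherwise. *)
Lemma hirsch_series_rank (H : set Q) h : hirsch_series H h -> rank_is H h.
Proof.
elim=> {H h} [|K H x h _ [r [B [Bf BK KB hE]]] nKH HE [n n0 Kxn]
              |K H x h _ [r [B [Bf BK KB hE]]] nKH HE Kx].
- exists 0, 0%R; split=> [| [] //|_ ->|]; first by rewrite /row_free mxrank0.
    by rewrite /W w1 map_mx0 sub0mx.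
  by rewrite /has_kernel asboolF // => -[c []].
- have [sK sH KH _] := nKH; have He := generated_cyclic_ext nKH HE.
  have Wx : (W x <= B)%MS.
    have := KB _ Kxn; rewrite WX -scaler_nat eqmx_scale // pnatr_eq0.
    by rewrite -lt0n.
  exists r, B; split=> // [i|g|].
  + by have [g Kg ->] := BK i; exists g => //; exact: KH.
  + move=> /He[k [i [j [Kk ->]]]]; rewrite !WM WV !WX.
    by rewrite !addmx_sub ?eqmx_opp ?KB // -scaler_nat scalemx_sub.
  rewrite hE; congr (_ + nat_of_bool _)%N; apply/asboolP/asboolP => -[c [cK c1 wc]].
    by exists c; split=> //; exact: KH.
  (* As c is central, k and u commute and c^n = k^n u^n, where u^n lies in K because x^n does. *)
  exists (c ^+ n); split; last by rewrite wX wc mul0rn.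
    have [k [i [j [Kk cE]]]] := He _ cK.
    set u := x ^+ i / x ^+ j in cE.
    have kE : k = c * u^-1 by rewrite cE mulgK.
    have cu : commute c u^-1 by apply: w_central.
    have -> : c = k * u by [].
    have ku : commute k u by rewrite kE; apply/commute_sym/commuteM;
      [exact/commute_sym/w_central|exact/commuteV].
    rewrite (expgMn _ ku); apply: is_subgroupM => //; first exact: is_subgroupX.
    rewrite /u expgnFl; last exact: commuteX2.
    rewrite -!expgnA !(mulnC _ n) !expgnA; apply: (is_subgroupM sK).
      exact: is_subgroupX.
    by apply: is_subgroupV => //; exact: is_subgroupX.
  by move=> cn; apply: c1; exact: tfQ cn.
have [sK sH KH _] := nKH; have He := generated_cyclic_ext nKH HE.
have Hx : H x by rewrite HE; apply: sub_generated; right.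
have [xB|xB] := boolP (W x <= B)%MS.
  have [n n0 [k Kk xk]] := rational_span sK BK xB.
  pose c := x ^+ n / k.
  have wc : w c = 0%R by rewrite /c wM wV xk subrr.
  have c1 : c <> 1 by move=> /divg1_eq E; apply: (Kx n n0); rewrite E.
  exists r, B; split=> // [i|g|].
  - by have [g Kg ->] := BK i; exists g => //; exact: KH.
  - move=> /He[k' [i [j [Kk' ->]]]]; rewrite !WM WV !WX.
    by rewrite !addmx_sub ?eqmx_opp ?KB // -scaler_nat scalemx_sub.
  have -> : has_kernel H = true.
    apply/asboolP; exists c; split=> //; apply: (is_subgroupM sH).
      exact: is_subgroupX.
    by apply: is_subgroupV => //; exact: KH.
  (* If K already met the kernel, [w_rank1] would put a power of c, and so a power of x, into K. *)
  suff E : has_kernel K = false by rewrite hE E addn0 addn1.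
  apply/asboolPn => -[c0 [Kc0 c01 wc0]].
  have [j j0 cj] := w_rank1 wc0 wc c01.
  have Kcj : K (c ^+ j) by apply: generated_min cj => // _ ->.
  apply: (Kx (n * j)%N); first by rewrite muln_gt0 n0.
  have xn : x ^+ n = c * k by rewrite /c mulgVK.
  rewrite expgnA xn expgMn; last exact: w_central.
  by apply: (is_subgroupM sK) => //; exact: is_subgroupX.
have BW : (B < B + W x)%MS.
  by rewrite ltmxE addsmxSl; apply: contra xB; apply: submx_trans; exact: addsmxSr.
exists (r + 1)%N, (col_mx B (W x)); split=> [|i|g|].
- have := rank_ltmx BW; rewrite (eqP Bf) addsmxE => Br.
  by rewrite /row_free eqn_leq rank_leq_row; apply: leq_trans Br; rewrite addn1.
- case: (split_ordP i) => e ->; last by exists x; rewrite // rowKd row_id.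
  by have [g Kg E] := BK e; exists g; [exact: KH|rewrite rowKu].
- move=> /He[k [i [j [Kk ->]]]]; rewrite -addsmxE !WM WV !WX.
  rewrite !addmx_sub ?eqmx_opp -?scaler_nat ?scalemx_sub ?addsmxSr //.
  by apply: submx_trans (KB _ Kk) _; exact: addsmxSl.
rewrite hE addn1 addSn; congr (_ + nat_of_bool _).+1%N.
apply/asboolP/asboolP => -[c [cK c1 wc]]; first by exists c; split=> //; exact: KH.
have [k [i [j [Kk cE]]]] := He _ cK.
(* For i different from j, W c = 0 would express W x rationally through the image of K. *)
exists c; split=> //; have [ij|ij] := eqVneq i j; first by rewrite cE ij mulgV mulg1.
exfalso; move/negP: xB; apply.
have : (W k + (i%:Z - j%:Z)%:~R *: W x = 0)%R.
  rewrite -[RHS](_ : W c = 0%R); last by rewrite /W wc map_mx0.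
  by rewrite cE !WM WV !WX -!scaler_nat rmorphB /= scalerBl.
move/eqP; rewrite addrC addr_eq0 => /eqP E.
have ij0 : ((i%:Z - j%:Z)%:~R != 0 :> rat)%R by rewrite intr_eq0 subr_eq0 eqz_nat.
by rewrite -(eqmx_scale _ ij0) E eqmx_opp KB.
Qed.

Lemma hirsch_eq h : (forall i : 'I_m, exists x, w x = delta_mx 0 i) ->
  (exists2 c, c <> 1 & w c = 0%R) -> hirsch_series [set: Q] h -> h = m.+1.
Proof.
move=> wd [c c1 wc] /hirsch_series_rank[r [B [/eqP Bf _ TB ->]]].
have -> : has_kernel [set: Q] = true by apply/asboolP; exists c.
rewrite addn1; congr _.+1; rewrite -[LHS]Bf; apply/eqP; rewrite -[_ == _]/(row_full B).
rewrite -sub1mx; apply/row_subP => i; rewrite row1; have [x wx] := wd i.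
have := TB x I; rewrite /W wx; congr (_ <= _)%MS.
by apply/rowP => j; rewrite !mxE; case: (_ && _).
Qed.

End HirschRank.

Section HirschExistence.
Local Open Scope group_scope.
Variable Q : groupType.

Lemma generated_rcons (A : set Q) x :
  generated (generated A `|` [set x]) = generated (A `|` [set x]).
Proof.
apply/seteqP; split; apply: generated_min; try exact: generated_subgroup.
- move=> y [Ay|->]; last by apply: sub_generated; right.
  by apply: generated_min Ay; [exact: generated_subgroup|move=> z Az; apply: sub_generated; left].
- move=> y [Ay|->]; last by apply: sub_generated; right.
  by apply: sub_generated; left; apply: sub_generated.
Qed.

Lemma hirsch_series_generated (s : seq Q) :
  (forall k, normal_in (generated [set` take k s]) [set: Q]) ->
  exists h, hirsch_series (generated [set` s]) h.
Proof.
elim/last_ind: s => [_|s x IH nor].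
  exists 0%N; rewrite [X in hirsch_series X _](_ : _ = [set 1]); first exact: HirschTriv.
  apply/seteqP; split; last by move=> _ ->; case: (generated_subgroup [set` ([::] : seq Q)]).
  by apply: generated_min => //; split=> // y z -> ->; rewrite mulgV.
have [k|h Hh] := IH.
  have [ks|sk] := leqP k (size s); first by have := nor k; rewrite -cats1 takel_cat.
  have := nor (size s); rewrite -cats1 take_size_cat // take_oversize //; exact: ltnW.
set K := generated [set` s] in Hh *.
have HE : generated [set` rcons s x] = generated (K `|` [set x]).
  rewrite generated_rcons; congr generated; apply/seteqP; split=> y /=.
    by rewrite mem_rcons inE => /orP[/eqP ->|]; [right|left].
  by rewrite mem_rcons inE => -[ys|->]; rewrite ?ys ?eqxx ?orbT.
have nK : normal_in K (generated [set` rcons s x]).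
  have := nor (size s); rewrite -cats1 take_size_cat // -/K => -[sK _ _ nK].
  split=> //; [exact: generated_subgroup| |by move=> k g Kk _; exact: nK].
  apply: generated_min; first exact: generated_subgroup.
  by move=> y ys; apply: sub_generated; rewrite /= mem_cat ys.
have [[k k0 Kk]|nKx] := pselect (exists2 k, (0 < k)%N & K (x ^+ k)).
  by exists h; apply: (HirschFin Hh nK HE); exists k.
by exists h.+1; apply: (HirschInf Hh nK HE) => k k0 Kk; apply: nKx; exists k.
Qed.

(** Listing the central generators first makes every prefix generate a normal subgroup: a prefix of
    [zs] is central, and a longer one contains all commutators. *)
Lemma hirsch_series_class2 (zs ys : seq Q) : (forall z, z \in zs -> forall y, z * y = y * z) ->
  (forall a b, generated [set` zs] [~ a, b]) -> generates [set` zs ++ ys] ->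
  exists h, hirsch_series [set: Q] h.
Proof.
move=> zc com <-; apply: hirsch_series_generated => k.
split=> //; first exact: generated_subgroup.
move=> a b Ka _; set K := generated _ in Ka *.
have sK : is_subgroup K by exact: generated_subgroup.
have [kz|zk] := leqP k (size zs).
  suff : K `<=` Defs.center Q by move=> /(_ _ Ka) ac; rewrite conjgE ac mulKg.
  apply: generated_min; first split=> [y|u v uc vc y]; first by rewrite mul1g mulg1.
    have vy : commute y v^-1 by apply: commuteV; rewrite /commute vc.
    by rewrite -mulgA -[v^-1 * y]vy !mulgA (uc y).
  by move=> y; rewrite /= takel_cat // => /mem_take/zc.
rewrite -[a ^ b](mulVKg a) -commgEl; apply: (is_subgroupM sK) => //.
apply: (generated_min sK _ (com a b)) => y yz; apply: sub_generated => /=.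
by rewrite take_cat ltnNge ltnW //= mem_cat yz.
Qed.

End HirschExistence.

(** * Quotients with cyclic center *)

Section CyclicCenter.
Local Open Scope group_scope.
Variable Q : groupType.

Lemma generated1P (c x : Q) : generated [set c] x -> exists n, x = c ^+ n \/ x = c ^- n.
Proof.
pose T := [set x : Q | exists i j, x = c ^+ i / c ^+ j].
have XC i j : commute (c ^+ i) (c ^+ j)^-1 by apply: commuteV; apply: commuteX2.
have sT : is_subgroup T.
  split=> [|_ _ [i [j ->]] [i' [j' ->]]]; first by exists 0, 0; rewrite mulgV.
  exists (i + j')%N, (j + i')%N; rewrite invgF !expgnDr invgM -!mulgA; congr (_ * _).
  by rewrite [LHS]mulgA -XC -!mulgA; congr (_ * _); rewrite -!invgM -!expgnDr addnC.
move=> /(generated_min sT)[|i [j ->]].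
  by move=> _ ->; exists 1%N, 0; rewrite expg0 invg1 mulg1.
have [ji|ij] := leqP j i; first by exists (i - j)%N; left; rewrite expgnFr.
by exists (j - i)%N; right; rewrite expgnFr ?invgF // ltnW.
Qed.

(** For x = c^(+-i) and y = c^(+-j), both x^j and y^i are c^(+-ij). *)
Lemma cyclic_commensurable (c x y : Q) : torsion_free Q ->
  generated [set c] x -> generated [set c] y -> x <> 1 ->
  exists2 j, (0 < j)%N & generated [set x] (y ^+ j).
Proof.
move=> tf /generated1P[i xi] /generated1P[j yj] x1.
have i0 : (0 < i)%N by rewrite lt0n; apply/eqP => i0; apply: x1; case: xi => ->; rewrite i0 ?invg1.
have sx := generated_subgroup [set x].
have Gx : generated [set x] x by exact: sub_generated.
have cx : x ^+ j = c ^+ (i * j) \/ x ^+ j = c ^- (i * j).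
  by case: xi => ->; [left|right]; rewrite ?expVgn expgnA.
have cy : y ^+ i = c ^+ (i * j) \/ y ^+ i = c ^- (i * j).
  by rewrite mulnC; case: yj => ->; [left|right]; rewrite ?expVgn expgnA.
have Gxj : generated [set x] (x ^+ j) by exact: (is_subgroupX j sx Gx).
have GxV := is_subgroupV sx Gxj.
by exists i => //; case: cx cy => E [] ->; rewrite -?E // E ?invgK in Gxj GxV *.
Qed.

Lemma finite_index_pow (A K : set Q) n c : is_subgroup K -> has_index A K n ->
  (forall i, A (c ^+ i)) -> exists2 j, (0 < j)%N & K (c ^+ j).
Proof.
move=> sK An Ac.
(* Pigeonhole: the n + 1 powers c^0, ..., c^n cannot lie in distinct cosets. *)
have [[s [t [Kst st]]]|no] := pselect (exists s t : 'I_n.+1, K ((c ^+ s)^-1 * c ^+ t) /\ s <> t).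
  have [lt|le] := ltnP s t.
    exists (t - s)%N; first by rewrite subn_gt0.
    rewrite expgnFr ?(ltnW lt) // (_ : _ / _ = (c ^+ s)^-1 * c ^+ t) //.
    by apply: commuteV; apply: commuteX2.
  exists (s - t)%N; first by rewrite subn_gt0 ltn_neqAle le andbT; apply/eqP => /val_inj/esym.
  rewrite expgnFr // -[X in K X]invgK invgF; apply: is_subgroupV => //.
  rewrite (_ : _ / _ = (c ^+ s)^-1 * c ^+ t) //.
  by apply: commuteV; apply: commuteX2.
have : (#|'I_n.+1| <= n)%N.
  apply: (leq_index (f := fun s : 'I_n.+1 => c ^+ s) sK An) => // s t Kst.
  by apply: contrapT => st; apply: no; exists s, t.
by rewrite card_ord ltnn.
Qed.

Lemma has_index_self (K : set Q) : is_subgroup K -> has_index K K 1.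
Proof.
move=> sK; rewrite /has_index; have -> : Defs.lcosets K K = [set K].
  apply/seteqP; split=> [_ [x Kx <-]|_ ->].
    apply/seteqP; split=> [_ [k Kk <-]|k Kk]; first exact: is_subgroupM.
    exists (x^-1 * k); last by rewrite mulVKg.
    by apply: is_subgroupM => //; exact: is_subgroupV.
  exists 1; first by case: sK.
  by apply/seteqP; split=> [_ [k Kk <-]|k Kk]; [rewrite mul1g|exists k; rewrite ?mul1g].
exact: card_set1.
Qed.

(** In class two, an element that is not central has a nontrivial commutator, which is central. [P]
    will be a direct factor. *)
Lemma central_in_ideal (P : set Q) a : (forall x y : Q, Defs.center Q [~ x, y]) ->
  (forall p q, P p -> P [~ p, q]) -> P a -> a <> 1 ->
  exists z, [/\ P z, z <> 1 & Defs.center Q z].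
Proof.
move=> com PR Pa a1.
have [ac|] := pselect (Defs.center Q a); first by exists a.
move=> /existsNP[q aq]; exists [~ a, q]; split=> //; first exact: PR.
by move=> /eqP/commgP.
Qed.

(** Each factor of a decomposition would contain a nontrivial central element. In a cyclic center
    some power of one lies in the subgroup generated by the other, hence in both factors, so it is
    trivial, against torsion-freeness. *)
Lemma irreducible_cyclic_center (c : Q) : torsion_free Q ->
  Defs.center Q `<=` generated [set c] ->
  (forall a b : Q, Defs.center Q [~ a, b]) -> irreducible_group Q.
Proof.
move=> tf cc com [A [B [[a a1] [b b1] [f [f' fK f'K]]]]].
have f1 : f 1 = (1, 1).
  by apply: (mulgI (f 1)); rewrite -gmulfM mulg1 [RHS]mulg1.
have fV x : f x^-1 = (f x)^-1.
  by apply: (mulgI (f x)); rewrite -gmulfM !mulgV f1.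
have fR x y : f [~ x, y] = [~ f x, f y] by rewrite !commgEl !conjgE !gmulfM !fV.
pose PA := [set q | (f q).2 = 1]; pose PB := [set q | (f q).1 = 1].
have [zA [PzA zA1 zAc]] : exists z, [/\ PA z, z <> 1 & Defs.center Q z].
  apply: (@central_in_ideal PA (f' (a, 1))) => // [p q pA||/(congr1 f)].
  - by rewrite /PA /= fR -[LHS]/[~ (f p).2, (f q).2] pA comm1g.
  - by rewrite /PA /= f'K.
  - by rewrite f'K f1 => -[].
have [zB [PzB zB1 zBc]] : exists z, [/\ PB z, z <> 1 & Defs.center Q z].
  apply: (@central_in_ideal PB (f' (1, b))) => // [p q pB||/(congr1 f)].
  - by rewrite /PB /= fR -[LHS]/[~ (f p).1, (f q).1] pB comm1g.
  - by rewrite /PB /= f'K.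
  - by rewrite f'K f1 => -[].
have [j j0 zAB] := cyclic_commensurable tf (cc _ zBc) (cc _ zAc) zB1.
have sPB : is_subgroup PB.
  split=> [|x y xB yB]; first by rewrite /PB /= f1.
  by rewrite /PB /= gmulfM fV -[LHS]/((f x).1 / (f y).1) xB yB mulgV.
have PBA : PB (zA ^+ j) by apply: (generated_min sPB _ zAB) => _ ->.
have sPA : is_subgroup PA.
  split=> [|x y xA yA]; first by rewrite /PA /= f1.
  by rewrite /PA /= gmulfM fV -[LHS]/((f x).2 / (f y).2) xA yA mulgV.
have PAA : PA (zA ^+ j) := is_subgroupX j sPA PzA.
apply: zA1; apply: (tf _ j) => //; apply: (can_inj fK); rewrite f1.
by rewrite [LHS]surjective_pairing PAA PBA.
Qed.

End CyclicCenter.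

Section QuotientMap.
Local Open Scope group_scope.
Variables (G : groupType) (N : normalSubgroup G).
Local Notation pi := (qpi N).

Lemma qpi_mulg x y : pi (x * y) = pi x * pi y.
Proof. exact: qpiM. Qed.

Lemma qpi_one : pi 1 = 1.
Proof. by []. Qed.

Lemma qpi_invg x : pi x^-1 = (pi x)^-1.
Proof. exact: qpiV. Qed.

Lemma qpi_expg x n : pi (x ^+ n) = pi x ^+ n.
Proof. by elim: n => [|n IH]; rewrite ?expg0 ?qpi_one // !expgS qpi_mulg IH. Qed.

Lemma qpi_commg x y : pi [~ x, y] = [~ pi x, pi y].
Proof. by rewrite !commgEl !conjgE !(qpi_mulg, qpi_invg). Qed.

Lemma qpi_eq1 x : pi x = 1 <-> nsub_set N x.
Proof.
rewrite -qpi_one; split=> [/esym/qpiP|Nx]; first by rewrite invg1 mul1g.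
by apply/esym/qpiP; rewrite invg1 mul1g.
Qed.

End QuotientMap.

Section CentralQuotient.
Variable d' : nat.
Local Notation d := d'.+1.
Local Notation H := (Gphi (@heis_mx d')).
Variable N : normalSubgroup H.
Local Notation Q := (quotient N).
Local Notation pi := (qpi N).

Lemma torsion_free_root (v : 'cV[int]_d) (c : int) : torsion_free Q -> c != 0 ->
  nsub_set N (hmk 0 0 (c *: v)) -> nsub_set N (hmk 0 0 v).
Proof.
move=> tf c0 Ncv; have [_ sN _ _] := nsubP N.
have {Ncv} Nv : nsub_set N (hmk 0 0 (v *+ absz c)).
  case: c c0 Ncv => n _; rewrite -[X in X *: v]intz scaler_int; first by rewrite -pmulrn.
  by rewrite NegzE mulrNz -pmulrn -hmk0V => /nsubV; rewrite invgK.
apply/qpi_eq1/(tf _ (absz c)); first by rewrite absz_gt0.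
by rewrite -qpi_expg hmk0X; apply/qpi_eq1.
Qed.

(* A normal subgroup with torsion-free quotient that is not central contains a multiple of every
   central element, by the norm, and hence the center. *)
Lemma subgroup_central : torsion_free Q ->
  (exists2 g, Defs.center H g & ~ nsub_set N g) ->
  forall u, nsub_set N u -> hx u = 0 /\ hy u = 0.
Proof.
move=> tf [g /heis_centerP[gx gy] Ng] u Nu; apply/heis_centerP; apply: contrapT => uc.
apply: Ng; rewrite -(hmkE g) gx gy.
have xy : hx u != 0 \/ hy u != 0.
  apply/orP; rewrite -negb_and; apply/negP => /andP[/eqP ? /eqP ?].
  by apply: uc; apply/heis_centerP.
have [n n0 /(_ (hz g))[x' [y' E]]] := heis_comm_norm xy.
apply: (torsion_free_root tf n0); rewrite -E -(hcommE _ _ (hz u) x' y' 0) hmkE.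
exact: comm_in (nsubP N) Nu.
Qed.

Hypothesis Nc : forall u, nsub_set N u -> hx u = 0 /\ hy u = 0.

Definition qw (q : Q) : 'rV[int]_(d + d) := row_mx (hx (repr q))^T (hy (repr q))^T.

(** Two representatives of a class differ by an element of N, whose x and y vanish by [Nc]. *)
Lemma qw_pi g : qw (pi g) = row_mx (hx g)^T (hy g)^T.
Proof.
have /qpiP/Nc : pi (repr (pi g)) = pi g by rewrite qpi_repr.
rewrite hxM hyM hxV hyV /qw => -[/eqP X /eqP Y].
by congr (row_mx _^T _^T); apply/eqP; rewrite eq_sym -subr_eq0 addrC.
Qed.

Lemma qwM x y : qw (x * y)%g = qw x + qw y.
Proof.
rewrite -[x]qpi_repr -[y]qpi_repr -qpi_mulg !qw_pi hxM hyM add_row_mx.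
by rewrite !linearD.
Qed.

Lemma qw0P q : qw q = 0 -> exists z, q = pi (hmk 0 0 z).
Proof.
rewrite -[q]qpi_repr qw_pi -row_mx0 => /eq_row_mx[/(congr1 trmx) X /(congr1 trmx) Y].
by rewrite !trmxK !trmx0 in X Y; exists (hz (repr q)); rewrite -{1}(hmkE (repr q)) X Y.
Qed.

Lemma pi_central z (q : Q) : (pi (hmk 0 0 z) * q = q * pi (hmk 0 0 z))%g.
Proof.
rewrite -[q]qpi_repr -!qpi_mulg; congr qpi.
by have /heis_centerP : hx (hmk 0 0 z) = 0 /\ hy (hmk 0 0 z) = 0; [rewrite !hmk_proj|exact].
Qed.

Lemma qw_central x : qw x = 0 -> forall y, (x * y = y * x)%g.
Proof. by move=> /qw0P[z ->]; exact: pi_central. Qed.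

Lemma comm_central (x y : Q) : exists v, [~ x, y]%g = pi (hmk 0 0 v).
Proof.
rewrite -[x]qpi_repr -[y]qpi_repr -qpi_commg -(hmkE (repr x)) -(hmkE (repr y)) hcommE.
by eexists.
Qed.

Lemma hirsch_quotient : torsion_free Q ->
  (forall c c', qw c = 0 -> qw c' = 0 -> c <> 1%g ->
     exists2 j, (0 < j)%N & generated [set c] (c' ^+ j)%g) ->
  (exists2 c, c <> 1%g & qw c = 0) -> hirsch Q = (d + d).+1.
Proof.
move=> tf rk1 exc.
pose zs := [seq pi (hmk 0 0 (delta_mx i 0)) | i : 'I_d].
pose ys := [seq pi (hmk (delta_mx i 0) 0 0) | i : 'I_d] ++
           [seq pi (hmk 0 (delta_mx i 0) 0) | i : 'I_d].
have Gz v : generated [set` zs] (pi (hmk 0 0 v)).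
  have sG := generated_subgroup [set` zs].
  move: v; apply: int_col_closed => [|u v Gu Gv|i].
  - by rewrite -hone; case: sG.
  - by rewrite -hmk0M -hmk0V qpi_mulg qpi_invg; case: sG => _; apply.
  - by apply: sub_generated; apply/mapP; exists i; rewrite ?mem_enum.
have [h Hh] : exists h, hirsch_series [set: Q] h.
  apply: (@hirsch_series_class2 _ zs ys) => [z /mapP[i _ ->]|a b|].
  - exact: pi_central.
  - by have [v ->] := comm_central a b.
  apply/seteqP; split=> // q _; rewrite -[q]qpi_repr.
  set K := generated _; have sK : is_subgroup K := generated_subgroup _.
  have : generated (@heis_gens d') (repr q) by rewrite heis_generates.
  apply: (@generated_min _ _ [set g | K (pi g)]).
    split=> [|x y Kx Ky]; first by rewrite /= qpi_one; case: sK.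
    by rewrite /= qpi_mulg qpi_invg; case: sK => _; apply.
  move=> g /=; case=> -[i _ <-]; apply: sub_generated; rewrite /= mem_cat; apply/orP; right;
    rewrite mem_cat; apply/orP; [left|right]; by apply/mapP; exists i; rewrite ?mem_enum.
have wd i : exists x, qw x = delta_mx 0 i.
  case: (split_ordP i) => j ->.
    exists (pi (hmk (delta_mx j 0) 0 0)); rewrite qw_pi !hmk_proj trmx_delta trmx0.
    apply/rowP => e; case: (split_ordP e) => a ->; rewrite ?row_mxEl ?row_mxEr !mxE;
      by rewrite ?(eq_lshift, eq_rshift, eq_lrshift, eq_rlshift).
  exists (pi (hmk 0 (delta_mx j 0) 0)); rewrite qw_pi !hmk_proj trmx_delta trmx0.
  apply/rowP => e; case: (split_ordP e) => a ->; rewrite ?row_mxEl ?row_mxEr !mxE;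
    by rewrite ?(eq_lshift, eq_rshift, eq_lrshift, eq_rlshift).
have hq k : hirsch_series [set: Q] k -> k = (d + d).+1.
  exact: (hirsch_eq qwM qw_central rk1 tf wd exc).
apply: hq; apply: (@xgetPex _ 0%N [set k | hirsch_series [set: Q] k]).
by exists h.
Qed.

End CentralQuotient.

(** * The value of psi *)

Section Psi.
Variable d' : nat.
Local Notation d := d'.+1.
Local Notation H := (Gphi (@heis_mx d')).
Local Notation base := (@hbase d').

Lemma hirsch_psi (g : H) (N : normalSubgroup H) n : Defs.center H g ->
  torsion_free (quotient N) -> qpi N g <> 1%g ->
  has_index (Defs.center (quotient N)) (generated [set qpi N g]) n ->
  hirsch (quotient N) = (d + d).+1.
Proof.
move=> gc tf g1 ix.
have Nc : forall u, nsub_set N u -> hx u = 0 /\ hy u = 0.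
  by apply: subgroup_central => //; exists g => // Ng; apply: g1; apply/qpi_eq1.
have [gx gy] := (heis_centerP g).1 gc.
have sg := generated_subgroup [set qpi N g].
(* The kernel of [qw] is central, so the finite index forces it to have rank one. *)
have cpow c' : qw c' = 0 -> exists2 j, (0 < j)%N & generated [set qpi N g] (c' ^+ j)%g.
  move=> wc; apply: (finite_index_pow sg ix) => i y.
  have cc : commute y c' by apply/commute_sym/(qw_central Nc wc).
  exact/commute_sym/commuteX.
apply: hirsch_quotient => // [c c' wc wc' c1|]; last first.
  by exists (qpi N g) => //; rewrite qw_pi // gx gy trmx0 row_mx0.
have [i i0 ci] := cpow _ wc; have [j j0 cj] := cpow _ wc'.
have ci1 : (c ^+ i)%g <> 1%g by move=> ci1; apply: c1; exact: tf i0 ci1.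
have [k k0 cjk] := cyclic_commensurable tf ci cj ci1.
exists (j * k)%N; first by rewrite muln_gt0 j0.
have sc := generated_subgroup [set c]; have cc : generated [set c] c by exact: sub_generated.
by rewrite expgnA; apply: (generated_min sc _ cjk) => _ ->; exact: (is_subgroupX i sc cc).
Qed.

(** The kernel, on the center, of the coefficient of 1. Dividing by it leaves an infinite cyclic
    center generated by the class of [base]. *)
Definition coef_kernel : set H := [set g | [/\ hx g = 0, hy g = 0 & hz g 0 0 = 0]].

Lemma coef_kernel_normal : normal_in coef_kernel [set: H].
Proof.
have sK : is_subgroup coef_kernel.
  split=> [|g h [gx gy gz] [hx0 hy0 hz0]].
    by split; rewrite ?hx1 ?hy1 // hz1 mxE.
  rewrite -(hmkE g) -(hmkE h) gx gy hx0 hy0 hmk0V hmk0M /coef_kernel /= !hmk_proj.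
  by split=> //; rewrite !mxE gz hz0 subrr.
split=> // g h Kg _; suff -> : (g ^ h = g)%g by [].
case: Kg => gx gy _; have gc : Defs.center H g by apply/heis_centerP.
by rewrite conjgE gc mulKg.
Qed.

Definition coef_nsub : normalSubgroup H := NormalSubgroup coef_kernel_normal.

Lemma coef_torsion_free : torsion_free (quotient coef_nsub).
Proof.
move=> q k k0; rewrite -[q]qpi_repr -qpi_expg => /qpi_eq1; set g := repr q.
move=> [X Y Z]; apply/qpi_eq1.
have gx : hx g = 0 by apply: (mulmxn_eq0 k0); rewrite -hxX.
have gy : hy g = 0 by apply: (mulmxn_eq0 k0); rewrite -hyX.
split=> //; move: Z; rewrite -(hmkE g) gx gy hmk0X !hmk_proj mulmxnE => /eqP.
by rewrite mulrn_eq0 -leqn0 leqNgt k0 => /eqP.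
Qed.

Lemma coef_center q : Defs.center (quotient coef_nsub) q ->
  generated [set qpi coef_nsub (hmk 0 0 base)] q.
Proof.
rewrite -[q]qpi_repr; set g := repr q => cg.
have [gx gy] : hx g = 0 /\ hy g = 0.
  apply/heis_centerP; apply: contrapT => gc.
  have xy : hx g != 0 \/ hy g != 0.
    apply/orP; rewrite -negb_and; apply/negP => /andP[/eqP ? /eqP ?].
    by apply: gc; apply/heis_centerP.
  (* The commutator becomes n times 1 with n nonzero, so the coefficient of 1 detects it in the
     quotient. *)
  have [n n0 /(_ base)[x' [y' E]]] := heis_comm_norm xy.
  have /commgP/eqP := cg (qpi coef_nsub (hmk x' y' 0)).
  rewrite -qpi_commg -(hmkE g) hcommE E => /qpi_eq1[_ _]; rewrite hmk_proj !mxE !eqxx mulr1.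
  exact/eqP.
set c := qpi _ _; have sc := generated_subgroup [set c].
have -> : qpi coef_nsub g = qpi coef_nsub (hmk 0 0 (hz g 0 0 *: base)).
  apply/qpiP; rewrite -(hmkE g) gx gy hmk0V hmk0M; split; rewrite !hmk_proj //.
  by rewrite !mxE !eqxx mulr1 addNr.
have cc : generated [set c] c by exact: sub_generated.
case: (hz g 0 0) => n; rewrite -[X in X *: base]intz scaler_int.
  by rewrite -pmulrn -hmk0X qpi_expg; exact: (is_subgroupX n sc cc).
rewrite NegzE mulrNz -pmulrn -hmk0V -hmk0X qpi_invg qpi_expg; apply: (is_subgroupV sc).
exact: (is_subgroupX n.+1 sc cc).
Qed.

(** All admissible N give the same Hirsch length by [hirsch_psi]; [coef_nsub] shows that there is
    one, so the minimum is not the default 0. *)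
Lemma psi_elt_base : psi_elt (hmk 0 0 base) = (d + d).+1.
Proof.
set g := hmk 0 0 base; set c := qpi coef_nsub g.
have gc : Defs.center H g by apply/heis_centerP; rewrite !hmk_proj.
have c1 : c <> 1%g.
  by move/qpi_eq1 => [_ _]; rewrite hmk_proj mxE !eqxx; apply/eqP; rewrite oner_eq0.
have cc : generated [set c] `<=` Defs.center (quotient coef_nsub).
  have ccen : Defs.center (quotient coef_nsub) c by move=> q; exact: pi_central.
  move=> q /generated1P[n [->|->]] y; apply/commute_sym; [|apply: commuteV];
    by apply: commuteX; exact/commute_sym.
have cE : Defs.center (quotient coef_nsub) = generated [set c].
  by apply/seteqP; split=> // q; exact: coef_center.
have ix : has_index (Defs.center (quotient coef_nsub)) (generated [set c]) 1.
  by rewrite cE; apply: has_index_self; exact: generated_subgroup.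
have tf := coef_torsion_free.
have irr : irreducible_group (quotient coef_nsub).
  apply: (irreducible_cyclic_center tf coef_center) => a b.
  by have [v ->] := comm_central a b; move=> q; exact: pi_central.
rewrite /psi_elt; suff /natmin_in[N [tfN _ [gN _] [n ixN] ->]] :
    [set h | exists N : normalSubgroup H,
    [/\ torsion_free (quotient N), irreducible_group (quotient N),
        qpi N g <> 1%g /\ generated [set qpi N g] `<=` Defs.center (quotient N),
        exists d, has_index (Defs.center (quotient N)) (generated [set qpi N g]) d
      & h = hirsch (quotient N)]] (hirsch (quotient coef_nsub)).
  exact: hirsch_psi gc tfN gN ixN.
by exists coef_nsub; split=> //; exists 1%N.
Qed.

Lemma psi_const_ge : (d <= psi_const H)%N.
Proof.
apply: (@leq_trans (d + d).+1); first by rewrite leqW // leq_addr.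
apply: (@natmax_ge _ _ (d + d).+1).
  (* The maximum exists because each [psi_elt g] is either (d + d).+1 or, when no N is admissible,
     the default 0. *)
  move=> _ [g [gc _ _] <-]; rewrite /psi_elt; set A := (X in natmin X).
  have [[k /natmin_in[N [tfN _ [gN _] [n ixN] ->]]]|A0] := pselect (exists k, A k).
    by rewrite (hirsch_psi gc tfN gN ixN).
  by rewrite natmin0 // => k Ak; apply: A0; exists k.
exists (hmk 0 0 base); last exact: psi_elt_base.
split; first by apply/heis_centerP; rewrite !hmk_proj.
  by rewrite hone => /(congr1 (@hz _)); rewrite !hmk_proj => /eqP; apply/negP/hbase_neq0.
exists 1%N, (hmk base 0 0), (hmk 0 base 0); split=> //; last by rewrite expg1 hmk_comm.
by rewrite heis_nil_class.
Qed.

End Psi.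

Theorem proposition1p2 (R : realType) :
  exists G : nat -> groupType,
    (forall n : nat,
       [/\ torsion_free (G n), finitely_generated (G n),
           two_step_nilpotent (G n), k_const R (G n) 1
         & RF_class (G n) (fun r : R => ln r ^+ 3)]) /\
    psi_const (G n) @[n --> \oo] --> \oo.
Proof.
have dE n : ((3 ^ n).-1.+1 = 3 ^ n)%N by rewrite prednK // expn_gt0.
(* The parameter of [heis_mx] is the degree minus one, hence the predecessor. *)
exists (fun n => Gphi (@heis_mx (3 ^ n).-1)); split=> [n|].
  split; [exact: heis_torsion_free|exact: heis_fg|exact: heis_two_step|exact: k_const_heis|].
  exact: RF_class_heis (dE n).
apply/cvgnyPge => A; exists A => // n /= An.
apply: leq_trans (psi_const_ge _); rewrite dE.
exact: leq_trans An (ltnW (ltn_expl n _)).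
Qed.
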